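(* Let $d$ be a sufficiently large integer, $\delta\in(0,1)$, $k=d^{1-\delta-o(1)}$, $s=d^{1-\delta/2}\log^2 d$, $\xi=2\exp(-\log^5 d)$. Then any deterministic $(k,n)$-communication protocol that solves the $(s,\xi)$-correlated orthogonal vector game with probability at least $1/2$ must have $n\ge d\cdot\exp(-\log d/\log\log d)$.
   Context: $\mathcal{H}_d=\{-1,1\}^d$, $\mathbb{B}^d$ the unit ball. $(s,\xi)$-correlated orthogonal vector game with a deterministic $(k,n)$-protocol: Alice receives $\mathbf{A}$ uniform in $\{-1,1\}^{(d/2)\times d}$, Bob receives $\mathbf{v}$ uniform in $\frac1{\sqrt d}\mathcal{H}_d$, independently. Round 1: Alice sends a message $\mathbf{M}\in\{0,1\}^{kd}$ depending on $\mathbf{A}$. Round 2: Bob sends $\mathbf{v}$ to Alice. Round 3: Alice sends $\mathbf{a}_1,\dots,\mathbf{a}_n$, each a row of $\mathbf{A}$ or the symbol $\mathsf{nil}$, depending on $(\mathbf{A},\mathbf{v})$. Bob outputs $\mathbf{x}\in\mathbb{B}^d$ depending on $(\mathbf{M},\mathbf{v},\mathbf{a}_1,\dots,\mathbf{a}_n)$. The protocol succeeds on $(\mathbf{A},\mathbf{v})$ if $\|\mathbf{A}\mathbf{x}\|_\infty\le\xi$ and $|\langle\mathbf{v},\mathbf{x}\rangle|\ge\sqrt{s/d}$; it solves the game with probability $p$ if it succeeds with probability at least $p$ over random $(\mathbf{A},\mathbf{v})$. *)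

(* Defs.v *)
From HB Require Import structures.
From mathcomp Require Import all_boot all_order all_algebra.
From mathcomp Require Import all_classical all_reals all_analysis.
Set Implicit Arguments. Unset Strict Implicit. Unset Printing Implicit Defensive.
Import Order.TTheory GRing.Theory Num.Theory.
Local Open Scope ring_scope.

(* ±1 entries are encoded by booleans: true ↦ 1, false ↦ -1. *)
Definition sgnR {R : realType} (b : bool) : R := if b then 1 else -1.

(* A deterministic (k,n)-protocol for dimension d (Alice gets d/2 rows).
   - alice1 : Alice's first message M ∈ {0,1}^{kd}, a function of A;
   - alice3 : Alice's third-round messages: for each of the n slots either
     nil (None) or (the index of) a row of A; Bob only receives the row
     contents, see [received_rows];
   - bob    : Bob's output x, a function of (M, v, a_1..a_n);
   - bob_ball : Bob's output always lies in the unit ball B^d. *)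
Record protocol (R : realType) (d k n : nat) := Protocol {
  alice1 : 'M[bool]_(d./2, d) -> (k * d).-tuple bool;
  alice3 : 'M[bool]_(d./2, d) -> 'rV[bool]_d -> n.-tuple (option 'I_(d./2));
  bob : (k * d).-tuple bool -> 'rV[bool]_d -> n.-tuple (option 'rV[bool]_d) -> 'rV[R]_d;
  bob_ball : forall m v a, \sum_(j < d) (bob m v a 0 j) ^+ 2 <= 1
}.

Definition received_rows (R : realType) d k n (P : protocol R d k n)
  (A : 'M[bool]_(d./2, d)) (v : 'rV[bool]_d) : n.-tuple (option 'rV[bool]_d) :=
  map_tuple (omap (fun i => row i A)) (alice3 P A v).

Definition output (R : realType) d k n (P : protocol R d k n)
  (A : 'M[bool]_(d./2, d)) (v : 'rV[bool]_d) : 'rV[R]_d :=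
  bob P (alice1 P A) v (received_rows P A v).

(* Success on (A, v): ||A x||_inf <= xi and |<v, x>| >= sqrt(s/d),
   where the real vector v is (1/sqrt d) * (±1 entries). *)
Definition succeeds (R : realType) d k n (P : protocol R d k n) (s xi : R)
  (A : 'M[bool]_(d./2, d)) (v : 'rV[bool]_d) : bool :=
  let x := output P A v in
  [forall i : 'I_(d./2), `| \sum_(j < d) sgnR (A i j) * x 0 j | <= xi] &&
  (Num.sqrt (s / d%:R) <= `| \sum_(j < d) (sgnR (v 0 j) / Num.sqrt d%:R) * x 0 j |).

Definition success_prob (R : realType) d k n (P : protocol R d k n) (s xi : R) : R :=
  #|[set Av : 'M[bool]_(d./2, d) * 'rV[bool]_d | succeeds P s xi Av.1 Av.2]|%:R
  / #|{: 'M[bool]_(d./2, d) * 'rV[bool]_d}|%:R.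

Definition solves (R : realType) d k n (P : protocol R d k n) (s xi p : R) : Prop :=
  p <= success_prob P s xi.

(* Main.v *)
(* Write W = w + 1. Alice's third message names few rows of A, so Bob's output
   is a function of his message, of v and of a list of n rows. Choose a random
   set of rows that keeps each row with probability 1/W and let a new predictor
   use the rows outside the set together with a list of the sent rows inside it,
   which is about W times shorter: it simulates Bob on the first list that is
   consistent with that information, and a union bound over lists shows that
   any list violating few of the discarded rows violates few of the kept ones.
   After about ln ln d rounds, a last thinning avoids the sent rows altogether,
   with probability exp(- O(list size / W)). What remains is a set J of hidden
   rows and a predictor f(M, v, A) that ignores the rows in J and yet is almost
   orthogonal to nearly all of them. Fix M and the rows outside J: for many tuples
   v_1, ..., v_r the vectors f(v_j) admit no small integer combination that is
   nearly zero, and Siegel's lemma then shows that few sign vectors are almost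
   orthogonal to most of them. So J carries more information on A than the
   message M can account for. *)

Require Import Defs.
From HB Require Import structures.
From mathcomp Require Import all_boot all_order all_algebra.
From mathcomp Require Import all_classical all_reals all_analysis.
From mathcomp Require Import lra ring zify.
Import Order.TTheory GRing.Theory Num.Theory.
Local Open Scope ring_scope.

(** * Random thinning *)

(** One thinning would not do. Simulating Bob on a wrong but consistent list is safe only after a
    union bound over all lists, which costs about [ln d] errors per list entry. A round divides the
    hidden set by at most [2 * W], and lists and errors by [W] up to constants, so the ratio of list
    to hidden set worsens by a constant factor only. The errors, however, are governed by the list
    before the latest thinning and lag by a factor [W]. So [W] times a power of [ln d] must stay
    below [T = d ^ (1 / ln ln d)], the factor by which [n] is supposed smaller than [d]. Yet the
    accumulated thinning [W ^ L] must reach [d ^ (delta / 2)]: only then is avoiding the remaining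
    list not rarer than the tail [exp (- s / 128)] of a large correlation. With [L] near [ln ln d]
    the constants of all rounds multiply to a power of [ln d], and [W] near [T ^ (delta / 2)]
    suffices. Up to lower-order factors the hidden set then has [d ^ (1 - delta / 2)] rows and as
    many vectors can be sampled, and this product is set against the message length [k * d]. *)

Section Thinning.
Context {R : realType} {I : finType} (w : nat).
Implicit Types (J B S : {set I}) (c : {ffun I -> 'I_w.+1}).

(* A uniform colouring [c] keeps each index with probability [1 / w.+1],
   independently; sums over colourings stand for expectations. *)
Definition kept c : {set I} := [set i | c i == ord0].

Lemma sum_prod_ffun (F : I -> 'I_w.+1 -> R) :
  \sum_(c : {ffun I -> 'I_w.+1}) \prod_i F i (c i) = \prod_i \sum_b F i b.
Proof. by rewrite bigA_distr_bigA. Qed.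

Lemma card_colouring : #|{: {ffun I -> 'I_w.+1}}| = (w.+1 ^ #|I|)%N.
Proof. by rewrite card_ffun card_ord. Qed.

Lemma prod_if_card (A : {set I}) (x y : R) :
  \prod_i (if i \in A then x else y) = x ^+ #|A| * y ^+ #|~: A|.
Proof.
rewrite (bigID (mem A)) /=; congr (_ * _).
  rewrite (eq_bigr (fun=> x)) ?prodr_const // => i iA.
  by rewrite iA.
rewrite (eq_bigr (fun=> y)); last by move=> i /negbTE ->.
rewrite -prodr_const; apply: eq_bigl => i.
by rewrite inE.
Qed.

Lemma sum_kept (x y : R) : \sum_(b : 'I_w.+1) (if b == ord0 then x else y) = x + w%:R * y.
Proof.
rewrite big_ord_recl /= (eq_bigr (fun=> y)) //.
by rewrite sumr_const card_ord mulr_natl.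
Qed.

(** The colours are independent, so the joint generating function of the kept and the discarded part
    of [B] factors over indices. The tail bounds below are choices of [x] and [y]; [x = 0], [y = 1]
    gives the chance that all of [B] is discarded. *)
Lemma sum_weights B (x y : R) :
  \sum_(c : {ffun I -> 'I_w.+1}) x ^+ #|B :&: kept c| * y ^+ #|B :\: kept c|
  = ((x + w%:R * y) / w.+1%:R) ^+ #|B| * w.+1%:R ^+ #|I|.
Proof.
pose F i (b : 'I_w.+1) : R := if i \in B then (if b == ord0 then x else y) else 1.
rewrite (eq_bigr (fun c => \prod_i F i (c i))); last first.
  move=> c _; rewrite /F -big_mkcond /=.
  rewrite (bigID (fun i => c i == ord0)) /=; congr (_ * _).
    rewrite (eq_bigr (fun=> x)); last by move=> i /andP[_ ->].
    by rewrite -prodr_const; apply: eq_bigl => i; rewrite !inE.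
  rewrite (eq_bigr (fun=> y)); last by move=> i /andP[_ /negbTE ->].
  by rewrite -prodr_const; apply: eq_bigl => i; rewrite !inE andbC.
rewrite sum_prod_ffun.
rewrite (eq_bigr (fun i => if i \in B then x + w%:R * y else w.+1%:R)); last first.
  move=> i _; rewrite /F; case: (i \in B); first exact: sum_kept.
  by rewrite sumr_const card_ord.
rewrite prod_if_card exprMn exprVn -mulrA; congr (_ * _).
rewrite -(cardsC B) exprD mulKf // expf_neq0 // pnatr_eq0 //.
Qed.

Lemma card_ord_neq0 : \sum_(b : 'I_w.+1) (b != ord0)%:R = w%:R :> R.
Proof.
rewrite (eq_bigr (fun b => if b == ord0 then 0 else 1)) ?sum_kept ?add0r ?mulr1 //.
by move=> b _; case: (b == ord0).
Qed.

Lemma sum_kept_disjoint i (Z : {set I}) : i \notin Z ->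
  \sum_(c : {ffun I -> 'I_w.+1}) (i \in kept c)%:R * [disjoint Z & kept c]%:R
  = w.+1%:R^-1 * (w%:R / w.+1%:R) ^+ #|Z| * w.+1%:R ^+ #|I| :> R.
Proof.
move=> iZ.
pose F j (b : 'I_w.+1) : R :=
  if j == i then (b == ord0)%:R else if j \in Z then (b != ord0)%:R else 1.
rewrite (eq_bigr (fun c => \prod_j F j (c j))); last first.
  move=> c _; rewrite (bigD1 i) //= {1}/F eqxx inE; congr (_ * _).
  case: (boolP [disjoint Z & kept c]) => [dis|].
    rewrite big1 // => j ji; rewrite /F (negbTE ji).
    case: ifP => // jZ; have := disjointFr dis jZ.
    by rewrite inE => ->.
  rewrite disjoint_subset => /subsetPn[j jZ]; rewrite !inE negbK => /eqP cj.
  rewrite (bigD1 j) /=; last by apply: contraNneq iZ => <-.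
  rewrite /F jZ cj eqxx (_ : (j == i) = false) ?mul0r //.
  by apply/negbTE; apply: contraNneq iZ => <-.
rewrite sum_prod_ffun (bigD1 i) //= {1}/F eqxx.
have W0 : w.+1%:R != 0 :> R by rewrite pnatr_eq0.
have -> : \sum_(b : 'I_w.+1) (b == ord0)%:R = 1 :> R.
  rewrite (eq_bigr (fun b => if b == ord0 then 1 else 0)) ?sum_kept ?mulr0 ?addr0 //.
  by move=> b _; case: (b == ord0).
have -> : \prod_(j | j != i) \sum_b F j b =
    w.+1%:R^-1 * \prod_j (if j \in Z then w%:R else w.+1%:R) :> R.
  rewrite [in RHS](bigD1 i) //= (negbTE iZ) mulKf //.
  apply: eq_bigr => j ji; rewrite /F (negbTE ji).
  case: ifP => _; first exact: card_ord_neq0.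
  by rewrite sumr_const card_ord.
rewrite mul1r prod_if_card -mulrA; congr (_ * _).
rewrite exprMn exprVn -mulrA; congr (_ * _).
by rewrite -(cardsC Z) exprD mulKf // expf_neq0.
Qed.

Lemma markov_card (T : finType) (P : pred T) (f : T -> R) (a b : R) :
  (forall x, 0 <= f x) -> (forall x, P x -> a <= f x) -> \sum_x f x <= b ->
  #|[set x | P x]|%:R * a <= b.
Proof.
move=> f0 Pf; apply: le_trans.
rewrite mulr_natl -sumr_const [leRHS](bigID P) /=.
apply: ler_wpDr; first exact: sumr_ge0.
rewrite (eq_bigl P); last by move=> x; rewrite inE.
exact: ler_sum.
Qed.

End Thinning.

Lemma leq_card_bigcup (I T : finType) (D : I -> {set T}) :
  (#|\bigcup_i D i| <= \sum_i #|D i|)%N.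
Proof.
apply: (big_ind2 (fun (A : {set T}) (k : nat) => #|A| <= k)%N) => [|A a B b Aa Bb|//].
  by rewrite cards0.
by rewrite cardsU; apply: leq_trans (leq_subr _ _) (leq_add Aa Bb).
Qed.

Lemma exists_sum_ge0 {R : realType} (T : finType) (x0 : T) (g : T -> R) :
  0 <= \sum_x g x -> exists x, 0 <= g x.
Proof.
move=> s0; apply: contrapT => /forallNP h.
have : \sum_x g x < \sum_(x : T) 0.
  apply: ltr_sum => [|x _]; last by rewrite ltNge; apply/negP/h.
  by apply/hasP; exists x0 => //; exact: mem_index_enum.
by rewrite [ltRHS]big1 // ltNge s0.
Qed.

(** * Elementary bounds on the exponential *)

Section ExpBounds.
Context {R : realType}.
Implicit Types t : R.

Lemma expR1_le4 : expR 1 <= 4 :> R.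
Proof.
have h : 2^-1 <= expR (- 2^-1) :> R by have := expR_ge1Dx (- 2^-1 : R); lra.
have h2 : expR (2^-1) <= 2 :> R.
  by rewrite -[leLHS]invrK -expRN -[leRHS]invrK lef_pV2 ?posrE ?expR_gt0 ?invr_gt0.
have -> : 1 = 2^-1 + 2^-1 :> R by lra.
rewrite expRD; apply: (@le_trans _ _ (2 * 2)); last by lra.
by apply: ler_pM => //; exact: expR_ge0.
Qed.

Lemma expR_le1B t : 0 <= t <= 2^-1 -> expR (- (2 * t)) <= 1 - t.
Proof.
move=> /andP[t0 t1].
have h := expR_ge1Dx (2 * t).
have h3 : 1 <= expR (2 * t) * (1 - t).
  apply: (@le_trans _ _ ((1 + 2 * t) * (1 - t))); last by rewrite ler_pM2r //; lra.
  have : 0 <= t * (1 - 2 * t) by apply: mulr_ge0; lra.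
  lra.
by rewrite expRN -[leLHS]mulr1 ler_pdivrMl ?expR_gt0.
Qed.

Lemma expR_natM (n : nat) t : expR (n%:R * t) = expR t ^+ n.
Proof. by rewrite mulrC -expRM_natr. Qed.

End ExpBounds.

(** * Tail bounds for one thinning *)

Section ThinningTails.
Context {R : realType} {I : finType} (w : nat).
Local Notation W := (w.+1%:R : R).

Lemma thinning_exceeds (B : {set I}) (E E' : R) : (7 <= w)%N ->
  #|[set c : {ffun I -> 'I_w.+1} |
      (#|B :\: kept w c|%:R <= E) && (E' < #|B :&: kept w c|%:R)]|%:R
  <= expR (8 * E / W - E') * W ^+ #|I|.
Proof.
move=> w7.
have W8 : 8 <= W by rewrite ler_nat.
have W0 : 0 < W by lra.
have wE : w%:R = W - 1 by rewrite -natr1 addrK.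
pose y : R := 1 - 4 / W.
have t1 : 0 <= 4 / W <= 2^-1.
  apply/andP; split; first by rewrite divr_ge0 // (ltW W0).
  by rewrite ler_pdivrMr //; lra.
have ylb : expR (- (8 / W)) <= y.
  by have := @expR_le1B R _ t1; rewrite (_ : 2 * (4 / W) = 8 / W) //; ring.
have y0 : 0 <= y by exact: le_trans (expR_ge0 _) ylb.
have E0 c : #|B :\: kept w c|%:R <= E -> 0 <= E by exact: le_trans.
rewrite -(ler_pM2r (expR_gt0 (E' - 8 * E / W))) [leRHS]mulrAC -expRD addrA subrK subrr expR0 mul1r.
apply: (@markov_card _ _ _ (fun c => expR 1 ^+ #|B :&: kept w c| * y ^+ #|B :\: kept w c|)).
- by move=> c; rewrite mulr_ge0 // exprn_ge0 // expR_ge0.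
- move=> c /andP[h1 h2]; rewrite expRD; apply: ler_pM; rewrite ?expR_ge0 //.
    by rewrite -expR_natM mulr1 ler_expR ltW.
  apply: (@le_trans _ _ (expR (- (8 / W)) ^+ #|B :\: kept w c|)).
    rewrite -expR_natM ler_expR mulrN lerN2 (_ : 8 * E / W = E * (8 / W)); last by ring.
    by rewrite ler_wpM2r // divr_ge0 // (ltW W0).
  by apply: lerXn2r; rewrite ?nnegrE ?expR_ge0.
- rewrite sum_weights; apply: ler_piMl; first by rewrite exprn_ge0 // ltW.
  apply: exprn_ile1.
    by rewrite divr_ge0 ?(ltW W0) // addr_ge0 ?expR_ge0 ?mulr_ge0.
  have hW : (W - 1) * (4 / W) = 4 - 4 / W by field; rewrite gt_eqF.
  rewrite ler_pdivrMr // mul1r wE /y mulrBr mulr1 hW.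
  case/andP: t1 => _; move: (4 / W) => u hu; have := @expR1_le4 R; lra.
Qed.

Lemma thinning_large (S : {set I}) (q q' : R) : #|S|%:R <= q ->
  #|[set c : {ffun I -> 'I_w.+1} | q' < #|S :&: kept w c|%:R]|%:R
  <= expR (3 * q / W - q') * W ^+ #|I|.
Proof.
move=> Sq.
have W0 : 0 < W by rewrite ltr0n.
have wE : w%:R = W - 1 by rewrite -natr1 addrK.
rewrite -(ler_pM2r (expR_gt0 q')) [leRHS]mulrAC -expRD subrK.
apply: (@markov_card _ _ _ (fun c => expR 1 ^+ #|S :&: kept w c| * 1 ^+ #|S :\: kept w c|)).
- by move=> c; rewrite mulr_ge0 // exprn_ge0 // expR_ge0.
- by move=> c h; rewrite expr1n mulr1 -expR_natM mulr1 ler_expR ltW.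
- rewrite sum_weights ler_pM2r ?exprn_gt0 //.
  have h : (expR 1 + w%:R * 1) / W <= expR (3 / W).
    apply: le_trans (expR_ge1Dx _).
    rewrite mulr1 wE ler_pdivrMr // mulrDl mul1r divfK ?gt_eqF //.
    by have := @expR1_le4 R; lra.
  apply: (@le_trans _ _ (expR (3 / W) ^+ #|S|)).
    by apply: lerXn2r; rewrite ?nnegrE ?expR_ge0 // divr_ge0 ?(ltW W0) // addr_ge0 ?expR_ge0 ?mulr_ge0.
  rewrite -expR_natM ler_expR (_ : 3 * q / W = q * (3 / W)); last by ring.
  by rewrite ler_wpM2r // divr_ge0 // (ltW W0).
Qed.

(** Only indices of [J :\: S] are counted on the left: whether they are kept is independent of the
    fate of [S :&: J], so the expectation factors. *)
Lemma thinning_disjoint (J S : {set I}) :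
  #|J :\: S|%:R / W * (w%:R / W) ^+ #|S :&: J| * W ^+ #|I| <=
  \sum_(c : {ffun I -> 'I_w.+1}) #|J :&: kept w c|%:R * [disjoint S :&: J & kept w c]%:R.
Proof.
apply: (@le_trans _ _ (\sum_(c : {ffun I -> 'I_w.+1}) \sum_(i in J :\: S)
   (i \in kept w c)%:R * [disjoint S :&: J & kept w c]%:R)); last first.
  apply: ler_sum => c _; rewrite -big_distrl /= ler_wpM2r //.
  rewrite -natr_sum ler_nat.
  have -> : (\sum_(i in J :\: S) (i \in kept w c) = #|(J :\: S) :&: kept w c|)%N.
    rewrite -sum1_card big_mkcond [RHS]big_mkcond /=; apply: eq_bigr => i _.
    by rewrite finset.in_setI; case: (i \in J :\: S) => //=; case: (i \in kept w c).
  by apply: subset_leq_card; apply: finset.setSI; exact: finset.subsetDl.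
rewrite exchange_big /= (eq_bigr (fun i => W^-1 * (w%:R / W) ^+ #|S :&: J| * W ^+ #|I|)); last first.
  move=> i; rewrite inE => /andP[iS iJ]; apply: sum_kept_disjoint.
  by rewrite inE (negbTE iS).
by rewrite sumr_const -[leRHS]mulr_natl -!mulrA.
Qed.

Lemma sum_disjoint (Z : {set I}) :
  \sum_(c : {ffun I -> 'I_w.+1}) [disjoint Z & kept w c]%:R
  = (w%:R / W) ^+ #|Z| * W ^+ #|I| :> R.
Proof.
have := @sum_weights R I w Z 0 1; rewrite add0r mulr1 => <-.
apply: eq_bigr => c _; rewrite expr1n mulr1 -setI_eq0 -cards_eq0.
by case: #|_| => [|p]; rewrite ?expr0 ?exprS ?mul0r.
Qed.

Lemma expR_le_keep : (1 <= w)%N -> forall p : nat, expR (- (2 * p%:R / W)) <= (w%:R / W) ^+ p.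
Proof.
move=> w1 p; have W0 : 0 < W by rewrite ltr0n.
have W2 : 2 <= W by rewrite ler_nat.
have wE : w%:R = W - 1 by rewrite -natr1 addrK.
rewrite (_ : - (2 * p%:R / W) = p%:R * (- (2 * W^-1))); last by ring.
rewrite expR_natM; apply: lerXn2r; rewrite ?nnegrE ?expR_ge0 ?divr_ge0 //.
rewrite wE mulrBl mul1r divff ?gt_eqF // expR_le1B // invr_ge0 (ltW W0) /=.
by rewrite lef_pV2 ?posrE.
Qed.

End ThinningTails.

(** * Sums over sign vectors and sign matrices *)

Section SignSums.
Context {R : realType}.
Implicit Types x t : R.

Lemma expR_le_inv1B x : x < 1 -> expR x <= (1 - x)^-1.
Proof.
move=> x1; rewrite -[leLHS]invrK -expRN lef_pV2 ?posrE ?expR_gt0 ?subr_gt0 //.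
by have := expR_ge1Dx (- x); lra.
Qed.

(** The sharp exponent is [x ^+ 2 / 2]. The larger constant allows an elementary proof:
    [expR x <= (1 - x)^-1] for small [x], and [x <= 2 * x ^+ 2] from [2^-1] on. *)
Lemma expRD_opp_le x : expR x + expR (- x) <= 2 * expR (2 * x ^+ 2).
Proof.
wlog x0 : x / 0 <= x.
  move=> h; case: (leP 0 x) => [/h//|/ltW x0].
  by rewrite -(sqrrN x) addrC -{2}(opprK x); apply: h; rewrite oppr_ge0.
have [xs|xl] := leP x 2^-1.
- have h1 := @expR_le_inv1B x ltac:(lra).
  have h2 := @expR_le_inv1B (- x) ltac:(lra).
  have h3 := expR_ge1Dx (2 * x ^+ 2).
  have h4 : (1 - x)^-1 + (1 - - x)^-1 <= 2 * (1 + 2 * x ^+ 2).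
    have -> : (1 - x)^-1 + (1 - - x)^-1 = 2 / (1 - x ^+ 2).
      by field; apply/and3P; split; apply/eqP; nra.
    rewrite ler_pdivrMr; last by nra.
    have : 0 <= x ^+ 2 * (1 - 2 * x ^+ 2) by apply: mulr_ge0; nra.
    nra.
  lra.
- have h1 : expR x <= expR (2 * x ^+ 2) by rewrite ler_expR; nra.
  have h2 : expR (- x) <= expR (2 * x ^+ 2) by rewrite ler_expR; nra.
  lra.
Qed.

Lemma sum_prod_rV (T : finType) (d : nat) (F : 'I_d -> T -> R) :
  \sum_(a : 'rV[T]_d) \prod_j F j (a 0 j) = \prod_j \sum_b F j b.
Proof.
rewrite bigA_distr_bigA /= (reindex (fun f : {ffun 'I_d -> T} => \row_j f j)) /=.
  by apply: eq_bigr => f _; apply: eq_bigr => j _; rewrite mxE.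
exists (fun a : 'rV[T]_d => [ffun j => a 0 j]) => f _.
  by apply/ffunP => j; rewrite ffunE mxE.
by apply/rowP => j; rewrite mxE ffunE.
Qed.

Lemma sum_prod_rows (T : finType) (m d : nat) (F : 'I_m -> 'rV[T]_d -> R) :
  \sum_(A : 'M[T]_(m, d)) \prod_i F i (row i A) = \prod_i \sum_a F i a.
Proof.
rewrite bigA_distr_bigA /=.
rewrite (reindex (fun f : {ffun 'I_m -> 'rV[T]_d} => \matrix_(i < m) f i)) /=.
  by apply: eq_bigr => f _; apply: eq_bigr => j _; rewrite rowK.
exists (fun A : 'M[T]_(m, d) => [ffun i => row i A]) => f _.
  by apply/ffunP => j; rewrite ffunE rowK.
by apply/row_matrixP => j; rewrite rowK ffunE.
Qed.

Definition dotb {d} (a : 'rV[bool]_d) (x : 'rV[R]_d) : R :=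
  \sum_(j < d) sgnR (a 0 j) * x 0 j.

Lemma dotbN d (a : 'rV[bool]_d) (x : 'rV[R]_d) : dotb a (- x) = - dotb a x.
Proof. by rewrite -sumrN; apply: eq_bigr => j _; rewrite mxE mulrN. Qed.

Lemma sum_expR_dotb d (u : 'rV[R]_d) t :
  \sum_(a : 'rV[bool]_d) expR (t * dotb a u)
  <= 2 ^+ d * expR (2 * t ^+ 2 * \sum_j u 0 j ^+ 2).
Proof.
rewrite (eq_bigr (fun a : 'rV[bool]_d => \prod_j expR (t * (sgnR (a 0 j) * u 0 j)))); last first.
  by move=> a _; rewrite -expR_sum mulr_sumr.
rewrite (sum_prod_rV _ _ (fun j b => expR (t * (sgnR b * u 0 j)))).
have -> : 2 ^+ d = \prod_(j < d) 2 :> R by rewrite prodr_const card_ord.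
rewrite mulr_sumr expR_sum -big_split /=.
apply: ler_prod => j _; apply/andP; split; first by apply: sumr_ge0 => b _; exact: expR_ge0.
rewrite big_bool /= /sgnR mul1r mulN1r mulrN.
by apply: le_trans (expRD_opp_le _) _; rewrite exprMn mulrA.
Qed.

Lemma dotb_tail d (u : 'rV[R]_d) (U l : R) : 0 < U -> 0 <= l ->
  \sum_j u 0 j ^+ 2 <= U ->
  #|[set a : 'rV[bool]_d | l <= `|dotb a u|]|%:R <= 2 * 2 ^+ d * expR (- (l ^+ 2 / (8 * U))).
Proof.
move=> U0 l0 uU.
have half (z : 'rV[R]_d) : \sum_j z 0 j ^+ 2 <= U ->
    #|[set a : 'rV[bool]_d | l <= dotb a z]|%:R <= 2 ^+ d * expR (- (l ^+ 2 / (8 * U))).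
  (* This [t] minimizes [2 * t ^+ 2 * U - t * l]. *)
  move=> zU; pose t := l / (4 * U).
  have t0 : 0 <= t by rewrite divr_ge0 // mulr_ge0 // ltW.
  rewrite -(ler_pM2r (expR_gt0 (t * l))) -[leRHS]mulrA -expRD.
  apply: (@markov_card R _ _ (fun a => expR (t * dotb a z))).
  - by move=> a; exact: expR_ge0.
  - by move=> a h; rewrite ler_expR ler_wpM2l.
  - apply: le_trans (sum_expR_dotb _ _ _) _.
    rewrite ler_pM2l ?exprn_gt0 // ler_expR.
    apply: (@le_trans _ _ (2 * t ^+ 2 * U)).
      by rewrite ler_wpM2l // mulr_ge0 // sqr_ge0.
    by rewrite le_eqVlt; apply/orP; left; apply/eqP; rewrite /t; field; rewrite gt_eqF.
have sub : [set a : 'rV[bool]_d | l <= `|dotb a u|] \subset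
    [set a : 'rV[bool]_d | l <= dotb a u] :|: [set a : 'rV[bool]_d | l <= dotb a (- u)].
  by apply/fintype.subsetP => a; rewrite !inE dotbN ler_normr.
apply: (@le_trans _ _ (#|[set a : 'rV[bool]_d | l <= dotb a u]|%:R +
                       #|[set a : 'rV[bool]_d | l <= dotb a (- u)]|%:R)).
  rewrite -natrD ler_nat; apply: leq_trans (subset_leq_card sub) _.
  by rewrite cardsU leq_subr.
have h1 := half _ uU.
have h2 : #|[set a : 'rV[bool]_d | l <= dotb a (- u)]|%:R <= 2 ^+ d * expR (- (l ^+ 2 / (8 * U))).
  apply: half; rewrite (eq_bigr (fun j => u 0 j ^+ 2)) // => j _.
  by rewrite mxE sqrrN.
by rewrite -mulrA mulr_natl mulr2n lerD.
Qed.

End SignSums.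

(** * Robust families and Siegel's lemma *)

Lemma sum_ord_le {R : realType} (n : nat) (F : 'I_n -> R) (c : R) :
  (forall i, F i <= c) -> \sum_i F i <= n%:R * c.
Proof.
by move=> Fc; rewrite mulr_natl -[in leRHS](card_ord n) -sumr_const; apply: ler_sum.
Qed.

Section Siegel.
Context {R : realType} {r d : nat} (x : 'I_r -> 'rV[R]_d).
Context (x_le1 : forall j k, `|x j 0 k| <= 1).
Implicit Types (G : {set 'I_r}) (P : {set 'I_d}).

Definition combo (z : 'I_r -> int) (k : 'I_d) : R := \sum_j (z j)%:~R * x j 0 k.

Lemma truncn_eq_dist (a b : R) : 0 <= a -> 0 <= b ->
  Num.truncn a = Num.truncn b -> `|a - b| <= 1.
Proof.
move=> a0 b0 ab; have /andP[a1 a2] := truncn_itv a0; have /andP[b1 b2] := truncn_itv b0.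
rewrite ab in a1 a2; rewrite -natr1 in a2; rewrite -natr1 in b2.
by rewrite ler_norml; apply/andP; split; lra.
Qed.

(** Pigeonhole: there are more coefficient vectors with entries in [0..m] on [G] than cells of side
    [k'] for the values of their combinations on [P]; [z] is the difference of two vectors in one
    cell. *)
Lemma siegel G P (m Z : nat) (k' : R) : 0 < k' -> 2 * (r%:R * m%:R) / k' <= Z%:R ->
  (Z.+1 ^ #|P| < m.+1 ^ #|G|)%N ->
  exists z : 'I_r -> int, [/\ forall j, `|z j| <= m%:Z,
    forall j, j \notin G -> z j = 0, exists j, z j != 0 &
    forall p, p \in P -> `|combo z p| <= k'].
Proof.
move=> k0 hZ hlt.
pose A : {pred {ffun 'I_r -> 'I_m.+1}} := pffun_on ord0 G predT.
(* The shift by [r%:R * m%:R] makes the values nonnegative, as [truncn] requires; they then range up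
   to [2 * (r%:R * m%:R)], whence the condition on [Z]. *)
pose cell (c : {ffun 'I_r -> 'I_m.+1}) p : R := (\sum_j (c j)%:R * x j 0 p + r%:R * m%:R) / k'.
pose g (c : {ffun 'I_r -> 'I_m.+1}) : {ffun 'I_d -> 'I_Z.+1} :=
  [ffun p => if p \in P then inord (Num.truncn (cell c p)) else ord0].
have sum_bd (c : {ffun 'I_r -> 'I_m.+1}) p : `|\sum_j (c j)%:R * x j 0 p| <= r%:R * m%:R.
  apply: le_trans (ler_norm_sum _ _ _) _.
  apply: sum_ord_le => j; rewrite normrM normr_nat -[leRHS]mulr1.
  by apply: ler_pM => //; rewrite ler_nat -ltnS.
have val0 c p : 0 <= cell c p.
  by rewrite divr_ge0 ?(ltW k0) //; have := sum_bd c p; rewrite ler_norml => /andP[]; lra.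
have valZ c p : (Num.truncn (cell c p) < Z.+1)%N.
  rewrite ltnS -(ler_nat R); apply: (@le_trans _ _ (cell c p)).
    by rewrite truncn_le.
  apply: le_trans hZ; rewrite ler_pM2r ?invr_gt0 //.
  by have := sum_bd c p; rewrite ler_norml => /andP[]; lra.
have /dinjectivePn[c cA [c' /andP[/= cc' c'A] gcc']] : ~~ dinjectiveb g A.
  apply: contraL hlt => /dinjectiveP inj; rewrite -leqNgt.
  have <- : #|A| = (m.+1 ^ #|G|)%N by rewrite card_pffun_on cardT size_enum_ord.
  have <- : #|pffun_on (ord0 : 'I_Z.+1) P predT| = (Z.+1 ^ #|P|)%N.
    by rewrite card_pffun_on cardT size_enum_ord.
  rewrite -(card_in_image inj); apply: subset_leq_card; apply/fintype.subsetP => f.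
  move=> /fintype.imageP[c0 _ ->]; apply/pffun_onP; split => //.
  apply/fintype.subsetP => p; rewrite inE ffunE.
  by case: ifP => //; rewrite eqxx.
have off (e : {ffun 'I_r -> 'I_m.+1}) j : e \in A -> j \notin G -> e j = ord0.
  by move=> /pffun_onP[/supportP eG _]; exact: eG.
exists (fun j => (c j : nat)%:Z - (c' j : nat)%:Z); split.
- move=> j; have := ltn_ord (c j); have := ltn_ord (c' j); lia.
- by move=> j jG; rewrite (off c) // (off c') // subrr.
- apply/existsP; rewrite -negb_forall; apply: contra cc' => /forallP h.
  apply/eqP/ffunP => j; apply/val_inj; apply/eqP.
  by have := h j; rewrite subr_eq0 => /eqP[e]; apply/eqP; exact: esym e.
- move=> p pP; have /ffunP/(_ p) := gcc'; rewrite !ffunE pP => /(congr1 val) /=.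
  rewrite !inordK // => /(truncn_eq_dist _ _ (val0 _ _) (val0 _ _)).
  rewrite /cell -mulrBl normrM (gtr0_norm (x := k'^-1)) ?invr_gt0 // ler_pdivrMr // mul1r.
  apply: le_trans; rewrite le_eqVlt; apply/orP; left; apply/eqP; congr `| _ |.
  rewrite opprD addrACA subrr addr0 -sumrB /combo.
  by apply: eq_bigr => j _; rewrite -mulrBl rmorphB.
Qed.

Definition robust (m : nat) (eta : R) := forall z : 'I_r -> int,
  (forall j, `|z j| <= m%:Z) -> (exists j, z j != 0) -> exists k, eta <= `|combo z k|.

(* The [w] of interest are differences of 0/1 vectors supported on [P]. *)
Definition pivotal G P (ka : R) := forall w : 'I_d -> int,
  (forall k, `|w k| <= 1) -> (forall k, k \notin P -> w k = 0) -> (exists k, w k != 0) ->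
  exists2 j, j \in G & ka <= `|\sum_k (w k)%:~R * x j 0 k|.

(* Siegel's lemma gives a small combination [z] of the [x j], [j] in [G], that is
   tiny on [P] but, by robustness, not at some [k], and this [k] is a new pivot:
   if [w] is supported on [k |: P] and nearly orthogonal to all [x j], then
   pairing [w] with the combination bounds [w k * combo z k]. *)
Lemma pivotal_extend G P (m Z : nat) (k' ka eta : R) :
  0 < k' -> 0 < ka -> 2 * (r%:R * m%:R) / k' <= Z%:R -> (Z.+1 ^ #|P| < m.+1 ^ #|G|)%N ->
  d%:R * k' + r%:R * m%:R * ka < eta ->
  robust m eta -> pivotal G P ka -> exists2 k, k \notin P & pivotal G (k |: P) ka.
Proof.
move=> k0 ka0 hZ hlt heta rob piv; apply: contrapT => hno.
have [z [zm zG z0 zP]] := siegel G P m Z k' k0 hZ hlt.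
have [k] := rob z zm z0; apply/negP; rewrite -ltNge; apply: le_lt_trans heta.
have d1 : 1 <= d%:R :> R by case: (d) k => [[]//|d' _]; rewrite ler1n.
have [kP|kP] := boolP (k \in P).
  apply: le_trans (zP _ kP) _; rewrite -[leLHS]addr0 lerD //.
    by rewrite ler_peMl // ltW.
  by rewrite !mulr_ge0 // ltW.
have [w [wb wP w0 wG]] : exists w : 'I_d -> int, [/\ forall k, `|w k| <= 1,
    forall i, i \notin k |: P -> w i = 0, exists k, w k != 0 &
    forall j, j \in G -> `|\sum_k (w k)%:~R * x j 0 k| < ka].
  apply: contrapT => hw; apply: hno; exists k => // w wb wP w0.
  apply: contrapT => hj; apply: hw; exists w; split => // j jG.
  by rewrite ltNge; apply/negP => h; apply: hj; exists j.
have wk : w k != 0.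
  apply/eqP => wk0; have [] // := piv w wb _ w0 => [i iP|j jG].
    by have [->//|ik] := eqVneq i k; apply: wP; rewrite !inE negb_or ik.
  by apply/negP; rewrite -ltNge wG.
have wk1 : `|(w k)%:~R| = 1 :> R.
  rewrite -intr_norm; have := wb k; move: wk; rewrite -normr_gt0.
  by case: (`|w k|) => [[|[|n]]|n].
have E : \sum_j (z j)%:~R * (\sum_i (w i)%:~R * x j 0 i) = \sum_i (w i)%:~R * combo z i.
  rewrite /combo (eq_bigr (fun j => \sum_i (z j)%:~R * ((w i)%:~R * x j 0 i))); last first.
    by move=> j _; rewrite mulr_sumr.
  rewrite exchange_big /=; apply: eq_bigr => i _; rewrite mulr_sumr.
  by apply: eq_bigr => j _; rewrite mulrCA.
rewrite (bigD1 k) //= in E.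
have -> : `|combo z k| = `|(w k)%:~R * combo z k| by rewrite normrM wk1 mul1r.
rewrite -[(w k)%:~R * _](addrK (\sum_(i | i != k) (w i)%:~R * combo z i)) -E.
apply: le_trans (ler_normB _ _) _; rewrite addrC; apply: lerD.
- apply: le_trans (ler_norm_sum _ _ _) _.
  rewrite big_mkcond /=; apply: sum_ord_le => i; case: ifP => ik; last exact: ltW.
  have [iP|iP] := boolP (i \in P).
    rewrite normrM -intr_norm -[leRHS]mul1r; apply: ler_pM => //; last exact: zP.
    by rewrite -[1]/(1%:~R) ler_int; exact: wb.
  by rewrite wP ?mul0r ?normr0 ?ltW // !inE negb_or ik.
- apply: le_trans (ler_norm_sum _ _ _) _.
  rewrite -mulrA; apply: sum_ord_le => j; have [jG|jG] := boolP (j \in G).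
    rewrite normrM; apply: ler_pM => //; last exact/ltW/wG.
    by rewrite -intr_norm -[m%:R]/(m%:Z%:~R) ler_int; exact: zm.
  by rewrite zG // mul0r normr0 mulr_ge0 // ltW.
Qed.

(** The bound [Z.+1 <= m.+1 ^ 2] reduces the pigeonhole condition to [2 * #|P| < #|G|], so pivots
    can be added one by one until they number half of [G], rounded up. *)
Lemma exists_pivotal G (m Z : nat) (k' ka eta : R) :
  0 < k' -> 0 < ka -> 2 * (r%:R * m%:R) / k' <= Z%:R -> (0 < m)%N -> (Z.+1 <= m.+1 ^ 2)%N ->
  d%:R * k' + r%:R * m%:R * ka < eta -> robust m eta ->
  exists2 P : {set 'I_d}, #|P| = uphalf #|G| & pivotal G P ka.
Proof.
move=> k0 ka0 hZ m0 hZm heta rob.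
suff: forall t, (t.*2 <= #|G|.+1)%N -> exists2 P : {set 'I_d}, #|P| = t & pivotal G P ka.
  by apply; lia.
elim=> [_|t IH ht].
  exists finset.set0; first exact: cards0.
  by move=> w _ w0 [k]; rewrite w0 ?inE ?eqxx.
have [|P Pt piv] := IH; first lia.
have [|k kP pivk] := @pivotal_extend G P m Z k' ka eta k0 ka0 hZ _ heta rob piv.
  rewrite Pt; apply: leq_ltn_trans (_ : (m.+1 ^ 2) ^ t < _)%N.
    by case: (t) => // t'; rewrite leq_exp2r.
  by rewrite -expnM ltn_exp2l //; lia.
by exists (k |: P); rewrite ?cardsU1 ?kP ?Pt.
Qed.

Lemma card_masked P :
  #|[set a : 'rV[bool]_d | [forall k in P, ~~ a 0 k]]|%:R * 2 ^+ #|P| = 2 ^+ d :> R.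
Proof.
pose F (k : 'I_d) (b : bool) : R := if k \in P then (~~ b)%:R else 1.
have -> : #|[set a : 'rV[bool]_d | [forall k in P, ~~ a 0 k]]|%:R
    = \sum_(a : 'rV[bool]_d) \prod_k F k (a 0 k).
  rewrite -sum1_card natr_sum big_mkcond /=; apply: eq_bigr => a _; rewrite inE.
  case: ifP => [/forall_inP h|/forall_inPn[k kP]].
    by rewrite big1 // => k _; rewrite /F; case: ifP => // /h ->.
  by rewrite negbK => ak; rewrite (bigD1 k) //= /F kP ak mul0r.
rewrite sum_prod_rV (eq_bigr (fun k => if k \in P then 1 else 2)); last first.
  by move=> k _; rewrite big_bool /F; case: ifP => _ /=; rewrite ?add0r.
by rewrite prod_if_card expr1n mul1r mulrC -exprD cardsC card_ord.
Qed.

Definition orthogonal_signs G (xi : R) :=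
  [set a : 'rV[bool]_d | [forall j in G, `|dotb a (x j)| <= xi]].

(* Erasing the pivot coordinates is injective on almost orthogonal sign vectors. *)
Lemma card_orthogonal_signs G P (ka xi : R) : xi < ka -> pivotal G P ka ->
  #|orthogonal_signs G xi|%:R * 2 ^+ #|P| <= 2 ^+ d :> R.
Proof.
move=> xika piv; rewrite -(card_masked P) ler_pM2r ?exprn_gt0 // ler_nat.
pose f (a : 'rV[bool]_d) : 'rV[bool]_d := \row_k ((k \notin P) && a 0 k).
have inj : {in orthogonal_signs G xi &, injective f}.
  move=> a b; rewrite !inE => /forall_inP ha /forall_inP hb fab.
  pose w k : int := (a 0 k : nat)%:Z - (b 0 k : nat)%:Z.
  apply/rowP => k; apply: contrapT => abk.
  have [|||j jG] := piv w.
  - by move=> i; rewrite /w; case: (a 0 i); case: (b 0 i).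
  - move=> i iP; have /rowP/(_ i) := fab; rewrite !mxE iP /= /w => ->; exact: subrr.
  - by exists k; rewrite /w; move: abk; case: (a 0 k); case: (b 0 k).
  apply/negP; rewrite -ltNge; apply: le_lt_trans xika.
  have -> : \sum_k (w k)%:~R * x j 0 k = 2^-1 * (dotb a (x j) - dotb b (x j)).
    rewrite /dotb -sumrB mulr_sumr; apply: eq_bigr => i _; rewrite -mulrBl mulrA; congr (_ * _).
    by rewrite /w rmorphB /= /sgnR; case: (a 0 i); case: (b 0 i) => /=; lra.
  rewrite normrM ger0_norm; last by lra.
  have := ler_normB (dotb a (x j)) (dotb b (x j)).
  by have := ha _ jG; have := hb _ jG; lra.
rewrite -(card_in_imset inj); apply: subset_leq_card; apply/fintype.subsetP => b.
move=> /imsetP[a _ ->]; rewrite inE; apply/forall_inP => k kP.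
by rewrite mxE kP.
Qed.

Lemma inv2_uphalf g : (2 ^+ uphalf g)^-1 <= (3 / 4) ^+ g :> R.
Proof.
apply: (@le_trans _ _ ((3 / 4) ^+ (uphalf g).*2)); last first.
  by apply: ler_wiXn2l; [lra | lra | lia].
rewrite -muln2 mulnC exprM -exprVn; apply: lerXn2r; rewrite ?nnegrE; lra.
Qed.

Definition violators (xi : R) (a : 'rV[bool]_d) : {set 'I_r} :=
  [set j | xi < `|dotb a (x j)|].

(** The term of [a] is the one at the complement [G] of its violators; summing over all [G] only
    adds nonnegative terms. For fixed [G] the pivots leave a fraction of at most [2 ^- (#|G| / 2)],
    hence [(3 / 4) ^ #|G|], of the sign vectors, and the sum over [G] is a binomial expansion. The
    base 8 keeps [3 / 4 + 1 / 8] below 1. *)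
Lemma sum_violators (m Z : nat) (k' ka eta xi : R) :
  0 < k' -> 0 < ka -> 2 * (r%:R * m%:R) / k' <= Z%:R -> (0 < m)%N -> (Z.+1 <= m.+1 ^ 2)%N ->
  d%:R * k' + r%:R * m%:R * ka < eta -> robust m eta -> xi < ka ->
  \sum_(a : 'rV[bool]_d) 8^-1 ^+ #|violators xi a| <= 2 ^+ d * (7 / 8) ^+ r :> R.
Proof.
move=> k0 ka0 hZ m0 hZm heta rob xika.
apply: (@le_trans _ _ (\sum_(G : {set 'I_r}) #|orthogonal_signs G xi|%:R * 8^-1 ^+ #|~: G|)).
  have -> : \sum_(G : {set 'I_r}) #|orthogonal_signs G xi|%:R * 8^-1 ^+ #|~: G| =
     \sum_(a : 'rV[bool]_d) \sum_(G : {set 'I_r}) (a \in orthogonal_signs G xi)%:R * 8^-1 ^+ #|~: G| :> R.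
    rewrite exchange_big /=; apply: eq_bigr => G _; rewrite -big_distrl /=; congr (_ * _).
    by rewrite -sum1_card natr_sum big_mkcond /=; apply: eq_bigr => a _; case: ifP.
  apply: ler_sum => a _; rewrite (bigD1 (~: violators xi a)) //= finset.setCK.
  rewrite (_ : a \in _) ?mul1r; last first.
    by rewrite inE; apply/forall_inP => j; rewrite !inE -leNgt.
  by rewrite ler_wpDr // sumr_ge0 // => G _; rewrite mulr_ge0 // exprn_ge0 // invr_ge0.
apply: (@le_trans _ _ (\sum_(G : {set 'I_r}) 2 ^+ d * \prod_j (if j \in G then 3 / 4 else 8^-1))).
  apply: ler_sum => G _; rewrite prod_if_card mulrA ler_wpM2r ?exprn_ge0 ?invr_ge0 //.
  have [P PG piv] := exists_pivotal G m Z k' ka eta k0 ka0 hZ m0 hZm heta rob.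
  have := card_orthogonal_signs _ _ _ _ xika piv.
  rewrite -ler_pdivlMr ?exprn_gt0 // => /le_trans; apply.
  by rewrite ler_wpM2l ?exprn_ge0 // PG inv2_uphalf.
rewrite -mulr_sumr ler_wpM2l ?exprn_ge0 // -(bigA_distr _ _ (fun=> 3 / 4) (fun=> 8^-1)).
rewrite (eq_bigr (fun=> 7 / 8)) ?prodr_const ?card_ord // => j _ /=; lra.
Qed.

End Siegel.

(** * Sampling robust families *)

Lemma sum_tuple_cons {R : realType} (T : finType) (n : nat) (F : n.+1.-tuple T -> R) :
  \sum_t F t = \sum_(ys : n.-tuple T) \sum_v F (cons_tuple v ys).
Proof.
rewrite pair_big /= (reindex (fun p : n.-tuple T * T => cons_tuple p.2 p.1)) //=.
exists (fun t : n.+1.-tuple T => (behead_tuple t, thead t)) => [[ys v] _|t _] /=.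
  by congr (_, _) => //; apply: val_inj.
by rewrite [RHS]tuple_eta; apply: val_inj.
Qed.

Section RobustTuples.
Context {R : realType} {d : nat} (f : 'rV[bool]_d -> 'rV[R]_d) (m : nat) (sg eta : R).
Context (f_ball : forall v, \sum_j f v 0 j ^+ 2 <= 1).
Context (eta0 : 0 <= eta) (eta_d : d%:R * eta ^+ 2 <= 1) (eta_sg : d%:R * eta <= sg / 2).

Definition coef {n} (c : {ffun 'I_n -> 'I_m.*2.+1}) (j : 'I_n) : int := (c j : nat)%:Z - m%:Z.

(** The head of the tuple is the newly drawn vector. Relations that omit it are excluded by the
    robustness of the tail, so only those with nonzero leading coefficient matter. *)
Definition nearly_dependent n (t : n.+1.-tuple 'rV[bool]_d) : bool :=
  [exists c : {ffun 'I_n.+1 -> 'I_m.*2.+1}, (coef c ord0 != 0) &&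
    [forall k, `|combo (fun j => f (tnth t j)) (coef c) k| < eta]].

Lemma dotb_le_sum_norm (v : 'rV[bool]_d) (x : 'rV[R]_d) : `|dotb v x| <= \sum_k `|x 0 k|.
Proof.
apply: le_trans (ler_norm_sum _ _ _) _; apply: ler_sum => k _.
by rewrite /sgnR; case: (v 0 k); rewrite ?mul1r // mulN1r normrN.
Qed.

(* A near dependency with integer coefficients bounded by [m] confines [f v] to the
   vicinity of one of few vectors [u] that do not depend on [v], and [dotb v u] is
   rarely large. *)
Lemma card_nearly_dependent n (ys : n.-tuple 'rV[bool]_d) : 0 <= sg ->
  #|[set v | (sg <= `|dotb v (f v)|) && nearly_dependent n (cons_tuple v ys)]|%:R
  <= (m.*2.+1)%:R ^+ n.+1 * (2 * 2 ^+ d * expR (- (sg ^+ 2 / 128))).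
Proof.
move=> sg0.
pose D (c : {ffun 'I_n.+1 -> 'I_m.*2.+1}) := [set v | [&& sg <= `|dotb v (f v)|,
   coef c ord0 != 0 &
   [forall k, `|combo (fun j => f (tnth (cons_tuple v ys) j)) (coef c) k| < eta]]].
have sub : [set v | (sg <= `|dotb v (f v)|) && nearly_dependent n (cons_tuple v ys)]
    \subset \bigcup_c D c.
  apply/fintype.subsetP => v; rewrite inE => /andP[h /existsP[c hc]].
  by apply/bigcupP; exists c => //; rewrite inE h.
apply: (@le_trans _ _ (\sum_c #|D c|%:R)).
  rewrite -natr_sum ler_nat; apply: leq_trans (subset_leq_card sub) _.
  exact: leq_card_bigcup.
have -> : (m.*2.+1)%:R ^+ n.+1 = #|{: {ffun 'I_n.+1 -> 'I_m.*2.+1}}|%:R :> R.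
  by rewrite card_ffun !card_ord natrX.
rewrite mulr_natl -sumr_const; apply: ler_sum => c _.
(* A witness [v0] is needed because [u] has bounded norm only through its closeness to some
   [f v0]. *)
have [->|/set0Pn[v0 v0D]] := eqVneq (D c) finset.set0.
  by rewrite cards0 !mulr_ge0 ?exprn_ge0 ?expR_ge0.
move: (v0D); rewrite inE => /and3P[_ c0 _].
set z0 : R := (coef c ord0)%:~R.
have z0n : z0 != 0 by rewrite intr_eq0.
have z01 : 1 <= `|z0|.
  rewrite /z0 -intr_norm -[1]/(1%:~R) ler_int.
  by move: c0; rewrite -normr_gt0; case: (`|_|) => [[|]|].
pose u : 'rV[R]_d := \row_k (- z0^-1 *
  \sum_(j < n) (coef c (lift ord0 j))%:~R * f (tnth ys j) 0 k).
have close v : v \in D c -> forall k, `|f v 0 k - u 0 k| <= eta.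
  rewrite inE => /and3P[_ _ /forallP h] k; have /ltW := h k.
  rewrite /combo big_ord_recl /= tnth0.
  rewrite (eq_bigr (fun j : 'I_n => (coef c (lift ord0 j))%:~R * f (tnth ys j) 0 k)); last first.
    by move=> j _; rewrite tnthS.
  rewrite mxE mulNr opprK -/z0 => hk.
  apply: le_trans hk; set S := \sum_(_ | _) _.
  have -> : z0 * f v 0 k + S = z0 * (f v 0 k + z0^-1 * S) by rewrite mulrDr mulVKf.
  by rewrite normrM ler_peMl.
have ub v : v \in D c -> \sum_j u 0 j ^+ 2 <= 4.
  move=> vD; apply: (@le_trans _ _ (\sum_j (2 * f v 0 j ^+ 2 + 2 * eta ^+ 2))).
    apply: ler_sum => j _; have := close v vD j; rewrite ler_norml => /andP[].
    move: (f v 0 j) (u 0 j) => a b h1 h2.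
    rewrite -subr_ge0.
    have -> : 2 * a ^+ 2 + 2 * eta ^+ 2 - b ^+ 2 =
      2 * ((eta - (a - b)) * (eta + (a - b))) + (2 * a - b) ^+ 2 by ring.
    by rewrite addr_ge0 ?sqr_ge0 // mulr_ge0 // mulr_ge0; lra.
  have -> : 4 = 2 * 1 + 2 * 1 :> R by ring.
  rewrite big_split /= -mulr_sumr; apply: lerD; first by rewrite ler_pM2l.
  by rewrite -mulr_sumr ler_pM2l // sumr_const card_ord -mulr_natl.
apply: le_trans (_ : #|[set v | sg / 2 <= `|dotb v u|]|%:R <= _).
  rewrite ler_nat; apply: subset_leq_card; apply/fintype.subsetP => v vD.
  have := close v vD; move: (vD); rewrite !inE => /and3P[h _ _] hk.
  have e : dotb v u = dotb v (f v) - dotb v (f v - u).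
    by rewrite /dotb -sumrB; apply: eq_bigr => j _; rewrite !mxE; ring.
  have b1 : `|dotb v (f v - u)| <= d%:R * eta.
    apply: le_trans (dotb_le_sum_norm _ _) _; apply: sum_ord_le => k.
    by rewrite !mxE; have := hk k; rewrite !mxE.
  have := ler_normD (dotb v u) (dotb v (f v - u)).
  rewrite {1}e subrK; move: h (le_trans b1 eta_sg); clear; lra.
have := @dotb_tail R d u 4 (sg / 2) ltac:(lra) ltac:(lra) (ub v0 v0D).
by rewrite (_ : (sg / 2) ^+ 2 / (8 * 4) = sg ^+ 2 / 128) //; field.
Qed.

Lemma robust_cons n (v : 'rV[bool]_d) (ys : n.-tuple 'rV[bool]_d) :
  robust (fun j => f (tnth ys j)) m eta -> ~~ nearly_dependent n (cons_tuple v ys) ->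
  robust (fun j => f (tnth (cons_tuple v ys) j)) m eta.
Proof.
move=> rob; rewrite negb_exists => /forallP nd z zm [j zj].
have [z0|z0] := eqVneq (z ord0) 0.
  have [||k hk] := rob (fun i => z (lift ord0 i)).
  - by move=> i; exact: zm.
  - case: (unliftP ord0 j) => [i ji|j0]; first by exists i; rewrite -ji.
    by rewrite j0 z0 eqxx in zj.
  exists k; rewrite /combo big_ord_recl z0 mul0r add0r.
  by under eq_bigr do rewrite tnthS.
pose c : {ffun 'I_n.+1 -> 'I_m.*2.+1} := [ffun i => inord (absz (z i + m%:Z))].
have cE i : coef c i = z i.
  rewrite /coef ffunE inordK; have := zm i; lia.
have := nd c; rewrite cE z0 /= => /forallPn[k]; rewrite -leNgt => hk; exists k.
by apply: le_trans hk _; rewrite /combo; under eq_bigr do rewrite cE.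
Qed.

(** The vectors are drawn one at a time: [V] has density at least [2 * th], and at most a density
    [th] of it breaks robustness, so every step leaves [th * 2 ^+ d] choices. *)
Lemma sum_robust_tuples n (V : {set 'rV[bool]_d}) (th : R) : 0 <= sg -> 0 <= th ->
  (forall v, v \in V -> sg <= `|dotb v (f v)|) ->
  2 * th * 2 ^+ d <= #|V|%:R ->
  (m.*2.+1)%:R ^+ n * (2 * expR (- (sg ^+ 2 / 128))) <= th ->
  (th * 2 ^+ d) ^+ n <=
  \sum_(t : n.-tuple 'rV[bool]_d)
    (`[< robust (fun j => f (tnth t j)) m eta >] && [forall j, tnth t j \in V])%:R.
Proof.
move=> sg0 th0 Vsg Vth; elim: n => [|n IH] hth.
  rewrite expr0 (bigD1 [tuple]) //= (_ : _ && _ = true) ?ler_wpDr ?sumr_ge0 //.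
  apply/andP; split; last by apply/forallP => [[]].
  by apply/asboolP => z _ [[]].
have M1 : 1 <= (m.*2.+1)%:R :> R by rewrite ler1n.
have e0 := expR_ge0 (- (sg ^+ 2 / 128)).
rewrite sum_tuple_cons exprSr.
apply: (@le_trans _ _ (\sum_(ys : n.-tuple 'rV[bool]_d)
    (`[< robust (fun j => f (tnth ys j)) m eta >] && [forall j, tnth ys j \in V])%:R * (th * 2 ^+ d))).
  rewrite -mulr_suml ler_wpM2r ?mulr_ge0 ?exprn_ge0 //; apply: IH.
  apply: le_trans hth; by rewrite ler_wpM2r ?mulr_ge0 // exprS ler_peMl //.
apply: ler_sum => ys _.
case: (boolP (_ && _)) => [/andP[/asboolP rob /forallP ysV]|_]; last first.
  by rewrite mul0r sumr_ge0.
rewrite mul1r.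
have cb := card_nearly_dependent n ys sg0.
set N := [set v | _] in cb.
apply: (@le_trans _ _ #|V :\: N|%:R).
  have : #|V|%:R <= #|V :\: N|%:R + #|N|%:R :> R.
    rewrite -natrD ler_nat -[X in (X <= _)%N](cardsID N V) addnC leq_add2l.
    by apply: subset_leq_card; exact: finset.subsetIr.
  have : (m.*2.+1)%:R ^+ n.+1 * (2 * 2 ^+ d * expR (- (sg ^+ 2 / 128))) <= th * 2 ^+ d.
    rewrite mulrAC mulrA ler_pM2r ?exprn_gt0 //.
  by move: Vth cb; lra.
rewrite -sum1_card natr_sum big_mkcond /=; apply: ler_sum => v _.
case: ifP => //; rewrite !inE => /andP[vN vV].
rewrite (_ : _ && _ = true) //; apply/andP; split.
  apply/asboolP; apply: robust_cons => //.
  by apply: contra vN => ->; rewrite Vsg.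
apply/forallP => j; case: (unliftP ord0 j) => [i ->|->]; last by rewrite tnth0.
by rewrite tnthS.
Qed.

End RobustTuples.

(** * Matrices with few violated rows *)

Section Counting.
Context {R : realType} {N d : nat}.
Local Notation mat := 'M[bool]_(N, d).

Definition bad_rows (xi : R) (A : mat) (x : 'rV[R]_d) : {set 'I_N} :=
  [set i | xi < `|dotb (row i A) x|].

Lemma expR_N3_le : expR (- 3) <= 8^-1 :> R.
Proof.
have h : 2 <= expR 1 :> R by have := expR_ge1Dx (1 : R); lra.
rewrite expRN lef_pV2 ?posrE ?expR_gt0 //.
have -> : expR 3 = expR 1 ^+ 3 :> R by rewrite -expR_natM mulr1.
have -> : 8 = 2 ^+ 3 :> R by rewrite -natrX.
by apply: lerXn2r; rewrite ?nnegrE // (le_trans _ h).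
Qed.

(** Rows in [J] vary independently, so the weight [8^-1] per violation sums to a product over [J].
    Counted by rows or by the [x j], the violations of a matrix in the set number at most
    [r%:R * E], so its weight is at least [expR (- 3 * (r * E))]. *)
Lemma card_few_bad_rows (r m Z : nat) (x : 'I_r -> 'rV[R]_d) (J : {set 'I_N}) (A0 : mat)
    (k' ka eta xi E : R) :
  (forall j k, `|x j 0 k| <= 1) ->
  0 < k' -> 0 < ka -> 2 * (r%:R * m%:R) / k' <= Z%:R -> (0 < m)%N -> (Z.+1 <= m.+1 ^ 2)%N ->
  d%:R * k' + r%:R * m%:R * ka < eta -> robust x m eta -> xi < ka ->
  #|[set A : mat | [forall (i | i \notin J), row i A == row i A0] &&
       [forall j, #|bad_rows xi A (x j) :&: J|%:R <= E]]|%:R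
  <= expR (3 * (r%:R * E)) * (2 ^+ d * (7 / 8) ^+ r) ^+ #|J|.
Proof.
move=> x1 k0 ka0 hZ m0 hZm heta rob xika.
pose phi i (a : 'rV[bool]_d) : R :=
  if i \in J then 8^-1 ^+ #|violators x xi a| else (a == row i A0)%:R.
rewrite mulrC -ler_pdivrMr ?expR_gt0 // -expRN.
apply: (@markov_card R _ _ (fun A : mat => \prod_i phi i (row i A))).
- by move=> A; apply: prodr_ge0 => i _; rewrite /phi; case: ifP => // _; rewrite exprn_ge0 ?invr_ge0.
- move=> A /andP[/forall_inP offJ /forallP few].
  rewrite (bigID (mem J)) /= [X in _ <= _ * X]big1 ?mulr1; last first.
    by move=> i iJ; rewrite /phi (negbTE iJ) (eqP (offJ _ iJ)) eqxx.
  rewrite (eq_bigr (fun i => 8^-1 ^+ #|violators x xi (row i A)|)); last first.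
    by move=> i iJ; rewrite /phi iJ.
  rewrite -expr_sum.
  have -> : (\sum_(i in J) #|violators x xi (row i A)| = \sum_j #|bad_rows xi A (x j) :&: J|)%N.
    rewrite (eq_bigr (fun i => \sum_j (j \in violators x xi (row i A)))%N); last first.
      by move=> i _; rewrite -sum1_card big_mkcond.
    rewrite exchange_big /=; apply: eq_bigr => j _.
    rewrite -sum1_card big_mkcond [RHS]big_mkcond /=; apply: eq_bigr => i _.
    by rewrite !inE; case: (i \in J); rewrite ?andbT ?andbF.
  apply: le_trans (_ : expR (- 3) ^+ _ <= _); last first.
    by apply: lerXn2r; rewrite ?nnegrE ?expR_ge0 ?invr_ge0 // expR_N3_le.
  rewrite -expR_natM ler_expR mulrN lerN2 mulrC ler_pM2l // natr_sum.
  exact: sum_ord_le.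
- rewrite sum_prod_rows (bigID (mem J)) /= [X in _ * X <= _]big1 ?mulr1; last first.
    move=> i iJ; rewrite /phi (negbTE iJ) (bigD1 (row i A0)) //= eqxx big1 ?addr0 //.
    by move=> a /negbTE ->.
  rewrite -prodr_const; apply: ler_prod => i iJ; rewrite /phi iJ sumr_ge0 /=.
    exact: sum_violators hZ m0 hZm heta rob xika.
  by move=> a _; rewrite exprn_ge0 ?invr_ge0.
Qed.

(** Double counting of pairs of a matrix in [F] and a robust tuple of vectors that are good for it:
    each matrix has many such tuples, and each robust tuple serves few matrices. Here [f] depends on
    [v] alone, since the message and the rows outside [J] are to be fixed. *)
Lemma card_fibre (f : 'rV[bool]_d -> 'rV[R]_d) (r m Z : nat) (J : {set 'I_N}) (A0 : mat)
    (F : {set mat}) (k' ka eta xi E sg th : R) :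
  (forall v, \sum_j f v 0 j ^+ 2 <= 1) ->
  0 < k' -> 0 < ka -> 2 * (r%:R * m%:R) / k' <= Z%:R -> (0 < m)%N -> (Z.+1 <= m.+1 ^ 2)%N ->
  d%:R * k' + r%:R * m%:R * ka < eta -> xi < ka ->
  d%:R * eta ^+ 2 <= 1 -> d%:R * eta <= sg / 2 -> 0 <= th ->
  (m.*2.+1)%:R ^+ r * (2 * expR (- (sg ^+ 2 / 128))) <= th ->
  (forall A, A \in F -> forall i, i \notin J -> row i A = row i A0) ->
  (forall A, A \in F -> 2 * th * 2 ^+ d <=
     #|[set v | (sg <= `|dotb v (f v)|) && (#|bad_rows xi A (f v) :&: J|%:R <= E)]|%:R) ->
  #|F|%:R * th ^+ r <= expR (3 * (r%:R * E)) * (2 ^+ d * (7 / 8) ^+ r) ^+ #|J|.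
Proof.
move=> fb k0 ka0 hZ m0 hZm heta xika eta_d eta_sg th0 hth FJ FV.
have eta0 : 0 <= eta.
  by apply: ltW; apply: le_lt_trans heta; rewrite addr_ge0 ?mulr_ge0 // ltW.
have sg0 : 0 <= sg by have h : 0 <= d%:R * eta := mulr_ge0 (ler0n _ _) eta0; lra.
have f1 v k : `|f v 0 k| <= 1.
  rewrite -(@ler_pXn2r _ 2) ?nnegrE // expr1n real_normK ?num_real //.
  apply: le_trans (fb v); rewrite (bigD1 k) //= lerDl sumr_ge0 // => j _; exact: sqr_ge0.
pose V A := [set v | (sg <= `|dotb v (f v)|) && (#|bad_rows xi A (f v) :&: J|%:R <= E)].
pose rb (t : r.-tuple 'rV[bool]_d) := `[< robust (fun j => f (tnth t j)) m eta >].
set Q := (X in _ <= X).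
have Q0 : 0 <= Q by rewrite mulr_ge0 ?expR_ge0 // exprn_ge0 // mulr_ge0 ?exprn_ge0 //; lra.
have card_tup : \sum_(t : r.-tuple 'rV[bool]_d) 1 = (2 ^+ d) ^+ r :> R.
  by rewrite sumr_const card_tuple card_mx card_bool mul1n natrX natrX.
rewrite -(ler_pM2r (_ : 0 < (2 ^+ d) ^+ r)) ?exprn_gt0 // -mulrA -exprMn.
apply: (@le_trans _ _ (\sum_(A in F) \sum_t (rb t && [forall j, tnth t j \in V A])%:R)).
  rewrite mulr_natl -sumr_const; apply: ler_sum => A AF.
  apply: (@sum_robust_tuples R d f m sg eta fb eta0 eta_d eta_sg r (V A) th sg0 th0) => //.
  - by move=> v; rewrite inE => /andP[].
  - exact: FV.
rewrite exchange_big /= -card_tup mulr_sumr; apply: ler_sum => t _; rewrite mulr1.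
case: (boolP (rb t)) => [/asboolP rob|_] /=; last by rewrite big1.
apply: le_trans (card_few_bad_rows r m Z (fun j => f (tnth t j)) J A0 k' ka eta xi E
   (fun j => f1 _) k0 ka0 hZ m0 hZm heta rob xika).
rewrite -natr_sum ler_nat -sum1_card big_mkcond [X in (_ <= X)%N]big_mkcond /=.
apply: leq_sum => A _; case: ifP => // AF; case: (boolP [forall j, _]) => //= /forallP tV.
rewrite inE (_ : _ && _ = true) //; apply/andP; split.
  by apply/forall_inP => i iJ; rewrite (FJ _ AF).
by apply/forallP => j; have := tV j; rewrite inE => /andP[].
Qed.

End Counting.

(** * Hiding rows stage by stage *)

Section Stages.
Context {R : realType} {N d : nat} {msg : finType}.
Local Notation mat := 'M[bool]_(N, d).
Local Notation vec := 'rV[bool]_d.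
Context (M : mat -> msg) (S : mat -> vec -> {set 'I_N}) (xi sg : R).
Implicit Types (J : {set 'I_N}) (A : mat) (v : vec).

Definition rows_of {e} (t : e.-tuple (option 'I_N)) : {set 'I_N} := [set i | Some i \in t].

Lemma card_rows_of e (t : e.-tuple (option 'I_N)) : (#|rows_of t| <= e)%N.
Proof.
have inj : injective (@Some 'I_N) by move=> ? ? [].
rewrite -(card_imset _ inj).
apply: leq_trans (_ : size t <= e)%N; last by rewrite size_tuple.
apply: leq_trans (card_size t); apply: subset_leq_card.
by apply/fintype.subsetP => o /imsetP[i]; rewrite inE => it ->.
Qed.

Lemma rows_of_surj e (B : {set 'I_N}) : (#|B| <= e)%N ->
  exists t : e.-tuple (option 'I_N), rows_of t = B.
Proof.
move=> Be; pose s := map Some (enum B) ++ nseq (e - #|B|) None.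
have ss : size s == e by rewrite size_cat size_map size_nseq -cardE subnKC.
exists (Tuple ss); apply/setP => i; rewrite inE /= mem_cat mem_nseq andbF orbF.
by rewrite mem_map ?mem_enum // => ? ? [].
Qed.

(* [X] predicts Bob's output from his message and vector, the rows of [A]
   outside [J], and the rows of [A] listed in a tuple of length [e]; on [G] some
   tuple that names the rows of [J] sent by Alice makes the prediction violate
   at most [E] rows of [J]. *)
Record stage (e : nat) (E : R) J (X : msg -> vec -> e.-tuple (option 'I_N) -> mat -> 'rV[R]_d)
    (G : {set mat * vec}) : Prop := Stage {
  stage_ball : forall m v t A, \sum_j X m v t A 0 j ^+ 2 <= 1;
  stage_local : forall m v t A A',
    (forall i, i \notin J \/ i \in rows_of t -> row i A = row i A') -> X m v t A = X m v t A';
  stage_good : forall A v, (A, v) \in G -> exists t,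
    [/\ rows_of t :&: J = S A v :&: J,
        #|bad_rows xi A (X (M A) v t A) :&: J|%:R <= E &
        sg <= `|dotb v (X (M A) v t A)|] }.

(** * Simulating Bob with a smaller hidden set *)

Section Refine.
Context {e : nat} {E : R} {J : {set 'I_N}}
  {X : msg -> vec -> e.-tuple (option 'I_N) -> mat -> 'rV[R]_d} {G : {set mat * vec}}
  (stX : stage e E J X G).

(** Violations are tested on [J :\: J'] because these rows are visible to the new predictor, while
    those of [J'] outside [tau] are not. *)
Definition consistent (J' : {set 'I_N}) m v (tau : {set 'I_N}) A (t : e.-tuple (option 'I_N)) :=
  [&& rows_of t :&: J' == tau, #|bad_rows xi A (X m v t A) :&: (J :\: J')|%:R <= E &
      sg <= `|dotb v (X m v t A)|].

Definition refine J' m v (tau : {set 'I_N}) A : 'rV[R]_d :=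
  if [pick t | consistent J' m v tau A t] is Some t then X m v t A else 0.

Lemma refine_ball J' m v tau A : \sum_j refine J' m v tau A 0 j ^+ 2 <= 1.
Proof.
rewrite /refine; case: pickP => [t _|_]; first exact: stage_ball stX _ _ _ _.
by rewrite big1 // => j _; rewrite mxE expr0n.
Qed.

Lemma refine_local J' m v (tau : {set 'I_N}) A A' : J' \subset J ->
  (forall i, i \notin J' \/ i \in tau -> row i A = row i A') ->
  refine J' m v tau A = refine J' m v tau A'.
Proof.
move=> J'J AA'.
have XX t : rows_of t :&: J' = tau -> X m v t A = X m v t A'.
  move=> rt; apply: (stage_local _ _ _ _ _ stX) => i [iJ|it]; apply: AA'.
    by left; apply: contra iJ; exact: (fintype.subsetP J'J).
  have [iJ'|iJ'] := boolP (i \in J'); last by left.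
  by right; rewrite -rt inE it.
have cc t : consistent J' m v tau A t = consistent J' m v tau A' t.
  rewrite /consistent; case: eqP => //= rt; rewrite -XX //; congr (_ && _).
  congr (_%:R <= _); apply: eq_card => i; rewrite !inE.
  by case: (boolP (i \in J')) => [|iJ']; rewrite ?andbF //= (AA' i) //; left.
rewrite /refine (eq_pick cc); case: pickP => // t /and3P[/eqP rt _ _].
by rewrite XX.
Qed.

(** All lists are quantified over, since the consistent list picked by [refine] need not be the one
    that Alice sent. *)
Definition separates J' (E' : R) A v := forall t,
  #|bad_rows xi A (X (M A) v t A) :&: (J :\: J')|%:R <= E ->
  #|bad_rows xi A (X (M A) v t A) :&: J'|%:R <= E'.

Lemma refine_good J' (E' : R) A v : J' \subset J -> (A, v) \in G -> separates J' E' A v ->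
  let x := refine J' (M A) v (S A v :&: J') A in
  #|bad_rows xi A x :&: J'|%:R <= E' /\ sg <= `|dotb v x|.
Proof.
move=> J'J /(stage_good _ _ _ _ _ stX)[t0 [rt0 bad0 c0]] sep /=.
rewrite /refine; case: pickP => [t /and3P[_ bt ct]|/(_ t0)/negP[]].
  by split => //; exact: sep.
apply/and3P; split => //.
  have JJ' (B : {set 'I_N}) : B :&: J' = B :&: J :&: J'.
    by rewrite -finset.setIA (finset.setIidPr J'J).
  by rewrite (JJ' (rows_of t0)) rt0 -JJ'.
apply: le_trans bad0; rewrite ler_nat; apply: subset_leq_card.
by apply: finset.setIS; exact: finset.subsetDl.
Qed.

End Refine.

(** * Existence of a good thinning *)

Section Choice.
Context {e : nat} {E : R} {J : {set 'I_N}}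
  {X : msg -> vec -> e.-tuple (option 'I_N) -> mat -> 'rV[R]_d} {G : {set mat * vec}}
  (stX : stage e E J X G) (w : nat) (l : R).
Context (w7 : (7 <= w)%N) (N_l : N.+1%:R <= expR l).
Local Notation W := (w.+1%:R : R).
Local Notation keep c := (J :&: kept w c).

Lemma card_not_separates (E' : R) A v :
  #|[set c : {ffun 'I_N -> 'I_w.+1} | ~~ `[< separates (X := X) (E := E) (J := J) (keep c) E' A v >]]|%:R
  <= expR (e%:R * l + 8 * E / W - E') * W ^+ N.
Proof.
pose B t := bad_rows xi A (X (M A) v t A) :&: J.
pose D (t : e.-tuple (option 'I_N)) := [set c : {ffun 'I_N -> 'I_w.+1} |
      (#|B t :\: kept w c|%:R <= E) && (E' < #|B t :&: kept w c|%:R)].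
apply: (@le_trans _ _ (\sum_t #|D t|%:R)).
  rewrite -natr_sum ler_nat; apply: leq_trans (leq_card_bigcup _ _ D).
  apply: subset_leq_card; apply/fintype.subsetP => c; rewrite inE => /asboolPn.
  move=> /existsNP[t /not_implyP[h1 /negP]]; rewrite -ltNge => h2.
  apply/bigcupP; exists t => //; rewrite inE; apply/andP; split.
    apply: le_trans h1; rewrite ler_nat; apply: subset_leq_card.
    apply/fintype.subsetP => i; rewrite !inE.
    by case: (i \in J); rewrite ?andbF ?andbT //= => /andP[-> ->].
  apply: (lt_le_trans h2); rewrite ler_nat; apply: subset_leq_card.
  by rewrite finset.setIA.
apply: (@le_trans _ _ (\sum_(t : e.-tuple (option 'I_N)) (expR (8 * E / W - E') * W ^+ N))).
  by apply: ler_sum => t _; have := @thinning_exceeds R 'I_N w (B t) E E' w7; rewrite card_ord.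
rewrite sumr_const card_tuple card_option card_ord -[leLHS]mulr_natl natrX -addrA [expR (e%:R * l + _)]expRD -[leRHS]mulrA.
rewrite ler_wpM2r ?mulr_ge0 ?expR_ge0 ?exprn_ge0 // expR_natM.
by apply: lerXn2r; rewrite ?nnegrE ?expR_ge0.
Qed.

Lemma sum_card_keep : \sum_(c : {ffun 'I_N -> 'I_w.+1}) #|keep c|%:R = #|J|%:R / W * W ^+ N.
Proof.
have W0 : W != 0 by rewrite pnatr_eq0.
rewrite (eq_bigr (fun c => \sum_(i in J) (i \in kept w c)%:R * [disjoint finset.set0 & kept w c]%:R)); last first.
  move=> c _; rewrite -sum1_card natr_sum big_mkcond [RHS]big_mkcond /=; apply: eq_bigr => i _.
  rewrite (_ : [disjoint _ & _] = true) ?mulr1.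
    by rewrite !inE; case: (i \in J) => //=; case: ifP.
  by rewrite disjoint_subset; apply/fintype.subsetP => j; rewrite inE.
rewrite exchange_big /= (eq_bigr (fun=> W^-1 * W ^+ N)).
  by rewrite sumr_const -[LHS]mulr_natl mulrA.
by move=> i _; rewrite sum_kept_disjoint ?inE // cards0 expr0 mulr1 card_ord.
Qed.

(** The summand [4 * l * (e%:R + 1)] of [E'] pays for the [expR (e%:R * l)] lists of the union bound
    and still leaves failure probability [expR (- (4 * l))]; the [4 * l] in [q'] does the same for
    the length of the thinned list. *)
Lemma next_stage (q' E' : R) : (0 < #|J|)%N ->
  3 * e%:R / W + 4 * l <= q' -> 8 * E / W + 4 * l * (e%:R + 1) <= E' -> 0 <= l ->
  exists J' X' (G' : {set mat * vec}),
    [/\ stage (Num.truncn q') E' J' X' G', G' \subset G,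
        #|J|%:R <= 2 * W * #|J'|%:R &
        #|G|%:R <= #|G'|%:R + 4 * W * expR (- (4 * l)) * #|{: mat * vec}|%:R].
Proof.
move=> J0 hq hE l0.
have W0 : 0 < W by rewrite ltr0n.
have q0 : 0 <= q' by apply: le_trans hq; rewrite addr_ge0 ?mulr_ge0 // divr_ge0 // mulr_ge0.
pose ok c A v := `[< separates (X := X) (E := E) (J := J) (keep c) E' A v >] &&
   (#|S A v :&: keep c|%:R <= q').
pose F c : {set mat * vec} := [set p in G | ~~ ok c p.1 p.2].
have fail A v : (A, v) \in G ->
    \sum_(c : {ffun 'I_N -> 'I_w.+1}) (~~ ok c A v)%:R <= 2 * expR (- (4 * l)) * W ^+ N.
  move=> AG; have [t0 [rt0 _ _]] := stage_good _ _ _ _ _ stX _ _ AG.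
  apply: (@le_trans _ _ (#|[set c : {ffun 'I_N -> 'I_w.+1} |
      ~~ `[< separates (X := X) (E := E) (J := J) (keep c) E' A v >]]|%:R +
      #|[set c : {ffun 'I_N -> 'I_w.+1} | q' < #|(S A v :&: J) :&: kept w c|%:R]|%:R)).
    rewrite -!sum1_card !natr_sum ![X in _ <= X + _]big_mkcond ![X in _ <= _ + X]big_mkcond.
    rewrite -big_split /=; apply: ler_sum => c _; rewrite !inE /ok negb_and -ltNge finset.setIA.
    by case: (~~ _) => /=; case: (_ < _); rewrite ?addr0 ?add0r // lerDl.
  have h1 := card_not_separates E' A v.
  have h2 := @thinning_large R 'I_N w (S A v :&: J) e%:R q'.
  have h3 : expR (e%:R * l + 8 * E / W - E') <= expR (- (4 * l)).
    rewrite ler_expR; have el : 0 <= e%:R * l by rewrite mulr_ge0.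
    move: hE el; rewrite (_ : 4 * l * (e%:R + 1) = 4 * (e%:R * l) + 4 * l); last by ring.
    by move: (8 * E / W) (e%:R * l) => *; lra.
  have h4 : expR (3 * e%:R / W - q') <= expR (- (4 * l)) by rewrite ler_expR; move: hq; move: (3 * e%:R / W) => *; lra.
  rewrite card_ord in h2.
  have -> : 2 * expR (- (4 * l)) * W ^+ N = expR (- (4 * l)) * W ^+ N + expR (- (4 * l)) * W ^+ N by ring.
  apply: lerD.
    by apply: (le_trans h1); rewrite ler_wpM2r ?exprn_ge0.
  have Ze : #|S A v :&: J|%:R <= e%:R :> R.
    rewrite -rt0 ler_nat; apply: leq_trans (card_rows_of _ t0).
    by apply: subset_leq_card; exact: finset.subsetIl.
  apply: (le_trans (h2 Ze)).
  by rewrite ler_wpM2r ?exprn_ge0.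
(* The colouring is chosen by averaging
   [#|keep c| - #|J| / (2 * W) - #|F c| * #|J| / beta], where [F c] collects the
   pairs lost for [c]: a nonnegative value bounds both [#|keep c|] from below and
   [#|F c|] from above. *)
pose beta := 4 * W * expR (- (4 * l)) * #|{: mat * vec}|%:R.
have O0 : 0 < #|{: mat * vec}|%:R :> R.
  by rewrite ltr0n; apply/card_gt0P; exists (\matrix_(i, j) true, \row_j true).
have beta0 : 0 < beta by rewrite !mulr_gt0 ?expR_gt0.
have [c hc] : exists c : {ffun 'I_N -> 'I_w.+1},
    0 <= #|keep c|%:R - #|J|%:R / (2 * W) - #|F c|%:R * (#|J|%:R / beta).
  apply: exists_sum_ge0; first exact: [ffun=> ord0].
  rewrite !sumrB sum_card_keep sumr_const card_ffun !card_ord -mulr_suml.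
  have hF : \sum_(c : {ffun 'I_N -> 'I_w.+1}) #|F c|%:R <=
      #|{: mat * vec}|%:R * (2 * expR (- (4 * l)) * W ^+ N).
    rewrite (eq_bigr (fun c => \sum_(p in G) (~~ ok c p.1 p.2)%:R)); last first.
      move=> c _; rewrite -sum1_card natr_sum big_mkcond [RHS]big_mkcond /=.
      by apply: eq_bigr => p _; rewrite inE; case: (p \in G) => //=; case: ifP.
    rewrite exchange_big /=.
    apply: (@le_trans _ _ (\sum_(p in G) (2 * expR (- (4 * l)) * W ^+ N))).
      by apply: ler_sum => -[A v] AG; exact: fail.
    rewrite sumr_const -[leLHS]mulr_natl ler_wpM2r ?mulr_ge0 ?expR_ge0 ?exprn_ge0 //.
    by rewrite ler_nat max_card.
  have e1 : #|J|%:R / W * W ^+ N - #|J|%:R / (2 * W) *+ (w.+1 ^ N) =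
     #|{: mat * vec}|%:R * (2 * expR (- (4 * l)) * W ^+ N) * (#|J|%:R / beta).
    rewrite -[_ *+ (w.+1 ^ N)]mulr_natl natrX /beta; field.
    by rewrite !gt_eqF ?expR_gt0 // ?ltr0n.
  by rewrite e1 subr_ge0 ler_wpM2r // divr_ge0 // ltW.
have JR0 : 0 < #|J|%:R :> R by rewrite ltr0n.
have FJ0 : 0 <= #|F c|%:R * (#|J|%:R / beta) by rewrite mulr_ge0 // divr_ge0 // ltW.
have keepJ : #|keep c|%:R <= #|J|%:R :> R.
  by rewrite ler_nat; apply: subset_leq_card; exact: finset.subsetIl.
exists (keep c), (fun m v (t : (Num.truncn q').-tuple _) A =>
  refine (J := J) (E := E) (X := X) (keep c) m v (rows_of t :&: keep c) A), (G :\: F c); split.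
- split.
  + by move=> m v t A; exact: refine_ball stX _ _ _ _ _.
  + move=> m v t A A' AA'; apply: (refine_local stX); first exact: finset.subsetIl.
    by move=> i [iJ|]; [apply: AA'; left|rewrite inE => /andP[it _]; apply: AA'; right].
  + move=> A v; rewrite !inE /= => /andP[+ AG]; rewrite AG /= negbK => /andP[/asboolP sep Sq].
    have [|t rt] := @rows_of_surj (Num.truncn q') (S A v :&: keep c).
      by rewrite truncn_ge_nat.
    exists t; rewrite rt -finset.setIA finset.setIid.
    by have [] := refine_good stX _ _ _ _ (finset.subsetIl _ _) AG sep; split.
- exact: finset.subsetDl.
- have : #|J|%:R / (2 * W) <= #|keep c|%:R by move: hc FJ0; move: (_ / (2 * W)) (_ * (_ / beta)) => *; lra.
  by rewrite ler_pdivrMr ?mulr_gt0 // mulrC.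
- have hb : #|F c|%:R <= beta.
    rewrite -(ler_pM2r (_ : 0 < #|J|%:R / beta)) ?divr_gt0 //.
    rewrite [leRHS]mulrC divfK ?gt_eqF //.
    have : 0 <= #|J|%:R / (2 * W) by rewrite divr_ge0 ?mulr_ge0 // ltW.
    by move: hc keepJ; move: (_ / (2 * W)) (_ * (_ / beta)) => *; lra.
  rewrite -lerBlDr; apply: le_trans (_ : #|G|%:R - #|F c|%:R <= _); first by rewrite lerB.
  rewrite lerBlDr -natrD ler_nat -[X in (X <= _)%N](cardsID (F c) G) addnC leq_add2l.
  by apply: subset_leq_card; exact: finset.subsetIr.
Qed.

(** Missing every sent row is itself a rare event, of probability down to about
    [expR (- (2 * e%:R / W))], so separation must fail more rarely still; the surplus of order
    [e%:R * l] in [E'] ensures this. No list remains, hence the empty [tau] for the new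
    predictor. *)
Lemma last_stage (E' : R) : (0 < #|J|)%N -> (0 < #|G|)%N ->
  8 * E / W + 4 * l * (e%:R + 1) <= E' -> 1 <= l -> 4 * e%:R <= #|J|%:R :> R ->
  8 * W <= expR (4 * l) ->
  exists J' (f : msg -> vec -> mat -> 'rV[R]_d) (G' : {set mat * vec}),
    [/\ forall m v A, \sum_j f m v A 0 j ^+ 2 <= 1,
        forall m v A A', (forall i, i \notin J' -> row i A = row i A') -> f m v A = f m v A',
        forall A v, (A, v) \in G' -> #|bad_rows xi A (f (M A) v A) :&: J'|%:R <= E' /\
           sg <= `|dotb v (f (M A) v A)|,
        #|J|%:R <= 2 * W * #|J'|%:R &
        #|G|%:R * (expR (- (2 * e%:R / W)) / (8 * W)) <= #|G'|%:R].
Proof.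
move=> J0 G0 hE l1 eJ hW.
have W0 : 0 < W by rewrite ltr0n.
have JR0 : 0 < #|J|%:R :> R by rewrite ltr0n.
have GR0 : 0 < #|G|%:R :> R by rewrite ltr0n.
pose pi : R := expR (- (2 * e%:R / W)) / (8 * W).
have pi0 : 0 < pi by rewrite divr_gt0 ?expR_gt0 ?mulr_gt0.
pose sep c A v := `[< separates (X := X) (E := E) (J := J) (keep c) E' A v >].
pose dis c A v := [disjoint S A v :&: J & kept w c].
pose G' c : {set mat * vec} := [set p in G | sep c p.1 p.2 && dis c p.1 p.2].
pose h : R := #|J|%:R / (2 * W).
have h0 : 0 <= h by rewrite divr_ge0 ?mulr_ge0 // ltW.
have keepJ c : #|keep c|%:R <= #|J|%:R :> R.
  by rewrite ler_nat; apply: subset_leq_card; exact: finset.subsetIl.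
have one A v : (A, v) \in G -> #|J|%:R * pi * W ^+ N <=
    \sum_(c : {ffun 'I_N -> 'I_w.+1}) (#|keep c|%:R - h) * (sep c A v && dis c A v)%:R.
  move=> AG; have [t0 [rt0 _ _]] := stage_good _ _ _ _ _ stX _ _ AG.
  set Z := S A v :&: J.
  have Ze : (#|Z| <= e)%N.
    by rewrite /Z -rt0; apply: leq_trans (card_rows_of _ t0); apply: subset_leq_card; exact: finset.subsetIl.
  pose om : R := (w%:R / W) ^+ #|Z|.
  have om_lb : expR (- (2 * e%:R / W)) <= om.
    apply: le_trans (@expR_le_keep R w _ #|Z|); last by apply: leq_trans w7.
    by rewrite ler_expR lerN2 ler_pM2r ?invr_gt0 // ler_pM2l // ler_nat.
  have s1 := @thinning_disjoint R 'I_N w J (S A v).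
  have s2 := @sum_disjoint R 'I_N w Z.
  have s3 := card_not_separates E' A v.
  rewrite !card_ord in s1 s2.
  have JS : 3 / 4 * #|J|%:R <= #|J :\: S A v|%:R :> R.
    have : #|J|%:R <= #|J :\: S A v|%:R + e%:R :> R.
      rewrite -natrD ler_nat -[X in (X <= _)%N](cardsID (S A v) J) addnC leq_add2l.
      by rewrite finset.setIC.
    by move: eJ; lra.
  apply: (@le_trans _ _ (\sum_(c : {ffun 'I_N -> 'I_w.+1})
     (#|keep c|%:R * (dis c A v)%:R - h * (dis c A v)%:R - #|J|%:R * (~~ sep c A v)%:R))); last first.
    apply: ler_sum => c _; case: (sep c A v) => /=.
      by rewrite mulr0 subr0 mulrBl.
    rewrite mulr0 mulr1; have := keepJ c.
    by case: (dis c A v) => /=; rewrite ?mulr1 ?mulr0 ?subr0; move: h0 JR0; lra.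
  rewrite !sumrB -!mulr_sumr s2 -/om.
  have s3' : \sum_(c : {ffun 'I_N -> 'I_w.+1}) (~~ sep c A v)%:R <=
      expR (- (2 * e%:R / W)) / (8 * W) * W ^+ N.
    have -> : \sum_(c : {ffun 'I_N -> 'I_w.+1}) (~~ sep c A v)%:R =
       #|[set c : {ffun 'I_N -> 'I_w.+1} | ~~ sep c A v]|%:R :> R.
      rewrite -sum1_card natr_sum [RHS]big_mkcond /=; apply: eq_bigr => c _.
      by rewrite inE; case: (~~ _).
    apply: (le_trans s3); rewrite ler_wpM2r ?exprn_ge0 // ler_pdivlMr ?mulr_gt0 //.
    apply: (@le_trans _ _ (expR (e%:R * l + 8 * E / W - E') * expR (4 * l))).
      by rewrite ler_wpM2l ?expR_ge0.
    rewrite -expRD ler_expR.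
    have : 2 * e%:R / W <= e%:R.
      rewrite ler_pdivrMr // mulrC ler_wpM2l // ler_nat.
      by apply: leqW; apply: leq_trans w7.
    have : e%:R <= e%:R * l by rewrite ler_peMr.
    move: hE; rewrite (_ : 4 * l * (e%:R + 1) = 4 * (e%:R * l) + 4 * l); last by ring.
    by move: l1 (ler0n R e); move: (8 * E / W) (2 * e%:R / W) (e%:R * l) => *; lra.
  have s1' : 3 / 4 * #|J|%:R / W * om * W ^+ N <=
    \sum_(c : {ffun 'I_N -> 'I_w.+1}) #|keep c|%:R * (dis c A v)%:R.
    apply: le_trans s1; rewrite ler_wpM2r ?exprn_ge0 // ler_wpM2r //.
      by rewrite exprn_ge0 // divr_ge0 // ltW.
    by rewrite ler_wpM2r ?invr_ge0 // ltW.
  have s3'' : #|J|%:R * (\sum_(c : {ffun 'I_N -> 'I_w.+1}) (~~ sep c A v)%:R) <= #|J|%:R * pi * W ^+ N.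
    by rewrite -mulrA ler_pM2l.
  have s4 : #|J|%:R * pi * W ^+ N <= #|J|%:R * (om / (8 * W)) * W ^+ N.
    by rewrite ler_pM2r ?exprn_gt0 // ler_pM2l // ler_pM2r // invr_gt0 mulr_gt0.
  have s5 : 3 / 4 * #|J|%:R / W * om * W ^+ N - h * (om * W ^+ N) = 2 * (#|J|%:R * (om / (8 * W)) * W ^+ N).
    by rewrite /h; field; rewrite gt_eqF.
  move: s1' s3'' s4 s5.
  move: (3 / 4 * _ / W * om * W ^+ N) (h * (om * W ^+ N)) (_ * (om / (8 * W)) * W ^+ N)
    (_ * pi * W ^+ N) (#|J|%:R * \sum_(c : _) _) (\sum_(c : _) _) => *; lra.
(* Subtracting [h], half the mean of [#|keep c|], makes one inequality do twice: positivity of the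
   product forces [h <= #|keep c|], and [#|keep c| <= #|J|] then bounds [#|G' c|] from below. *)
have [c hc] : exists c : {ffun 'I_N -> 'I_w.+1}, 0 <= (#|keep c|%:R - h) * #|G' c|%:R - #|G|%:R * (#|J|%:R * pi).
  apply: exists_sum_ge0; first exact: [ffun=> ord0].
  rewrite sumrB sumr_const card_ffun !card_ord subr_ge0.
  rewrite (eq_bigr (fun c => \sum_(p in G) (#|keep c|%:R - h) * (sep c p.1 p.2 && dis c p.1 p.2)%:R)); last first.
    move=> c _; rewrite -mulr_sumr; congr (_ * _).
    rewrite -sum1_card natr_sum big_mkcond [RHS]big_mkcond /=.
    by apply: eq_bigr => p _; rewrite inE; case: (p \in G) => //=; case: ifP.
  rewrite exchange_big /= -[leLHS]mulr_natr natrX -mulrA [leLHS]mulr_natl -sumr_const.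
  by apply: ler_sum => -[A v] AG; exact: one.
have GJ : 0 < #|G|%:R * (#|J|%:R * pi) by rewrite !mulr_gt0.
have hJ' : h <= #|keep c|%:R.
  rewrite -subr_ge0; move: hc GJ; set a := _ - h; set b := #|G' c|%:R => hc GJ.
  by have b0 : 0 <= b by []; case: (leP 0 a) => // a0; have : a * b <= 0 by [rewrite mulr_le0_ge0 // ltW]; lra.
exists (keep c), (fun m v A => refine (J := J) (E := E) (X := X) (keep c) m v finset.set0 A), (G' c); split.
- by move=> m v A; exact: refine_ball stX _ _ _ _ _.
- move=> m v A A' AA'; apply: (refine_local stX); first exact: finset.subsetIl.
  by move=> i [iJ|]; [apply: AA'|rewrite inE].
- move=> A v; rewrite !inE /= => /andP[AG /andP[/asboolP sp ds]].
  have := refine_good stX _ _ _ _ (finset.subsetIl _ _) AG sp.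
  have -> : S A v :&: keep c = finset.set0.
    by apply/eqP; rewrite finset.setIA setI_eq0.
  by case.
- by move: hJ'; rewrite /h ler_pdivrMr ?mulr_gt0 // mulrC.
- have : (#|keep c|%:R - h) * #|G' c|%:R <= #|J|%:R * #|G' c|%:R.
    by rewrite ler_wpM2r //; have := keepJ c; move: h0; lra.
  move=> h1; rewrite -(ler_pM2l JR0) -/pi mulrCA; apply: le_trans h1.
  by rewrite -subr_ge0.
Qed.

End Choice.
End Stages.

(** * Counting for a protocol *)

Section ProtocolCounting.
Context {R : realType} {d k n : nat} (P : protocol R d k n) (s xi l : R) (w : nat).
Context (d0 : (0 < d)%N) (s0 : 0 <= s) (w7 : (7 <= w)%N) (l1 : 1 <= l)
  (N0 : (0 < d./2)%N) (N_l : (d./2).+1%:R <= expR l).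
Local Notation N := (d./2).
Local Notation mat := 'M[bool]_(d./2, d).
Local Notation vec := 'rV[bool]_d.
Local Notation W := (w.+1%:R : R).
Local Notation Omega := (#|{: mat * vec}|%:R : R).

Fixpoint list_size (j : nat) : nat :=
  if j is j'.+1 then Num.truncn (3 * (list_size j')%:R / W + 4 * l) else n.

Fixpoint error_bound (j : nat) : R :=
  if j is j'.+1 then 8 * error_bound j' / W + 4 * l * ((list_size j')%:R + 1) else 0.

Definition sent_rows (A : mat) (v : vec) := rows_of (alice3 P A v).

Lemma succeedsP A v : succeeds P s xi A v ->
  bad_rows xi A (output P A v) = finset.set0 /\ Num.sqrt s <= `|dotb v (output P A v)|.
Proof.
case/andP => /forallP h1 h2; split.
  apply/setP => i; rewrite !inE; apply/negbTE; rewrite -leNgt.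
  apply: le_trans (h1 i); rewrite le_eqVlt; apply/orP; left; apply/eqP; congr `| _ |.
  by apply: eq_bigr => j _; rewrite mxE.
have sd : 0 < Num.sqrt d%:R :> R by rewrite sqrtr_gt0 ltr0n.
move: h2; have -> : \sum_(j < d) sgnR (v 0 j) / Num.sqrt d%:R * output P A v 0 j =
    dotb v (output P A v) / Num.sqrt d%:R.
  by rewrite /dotb mulr_suml; apply: eq_bigr => j _; rewrite mulrAC.
rewrite sqrtrM // sqrtrV // normrM (gtr0_norm (x := (Num.sqrt _)^-1)) ?invr_gt0 //.
by rewrite ler_pM2r // invr_gt0.
Qed.

Let stage := stage (N := d./2) (d := d) (alice1 P) sent_rows xi (Num.sqrt s).

Lemma initial_stage : stage n 0 [set: 'I_N]
  (fun m v t A => bob P m v (map_tuple (omap (fun i => row i A)) t))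
  [set p | succeeds P s xi p.1 p.2].
Proof.
split.
- by move=> m v t A; exact: bob_ball.
- move=> m v t A A' AA'; congr bob; apply: val_inj => /=; apply/eq_in_map => -[i|] //= it.
  by rewrite AA' //; right; rewrite inE.
- move=> A v; rewrite inE => /succeedsP[/= h1 h2]; exists (alice3 P A v); split => //.
  by rewrite [X in #|X :&: _|]h1 finset.set0I cards0.
Qed.

Let loss : R := 4 * W * expR (- (4 * l)).

Lemma iterated_stage j : 1 / 2 <= success_prob P s xi ->
  exists J X G, [/\ stage (list_size j) (error_bound j) J X G,
    N%:R <= (2 * W) ^+ j * #|J|%:R & Omega / 2 <= #|G|%:R + j%:R * loss * Omega].
Proof.
move=> hP; elim: j => [|j [J [X [G [st hJ hG]]]]].
  exists [set: 'I_N], (fun m v t A => bob P m v (map_tuple (omap (fun i => row i A)) t)),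
     [set p | succeeds P s xi p.1 p.2]; split.
  - exact: initial_stage.
  - by rewrite mul1r cardsT card_ord.
  - rewrite !mul0r addr0; move: hP; rewrite /success_prob ler_pdivlMr; first by rewrite mul1r mulrC.
    by rewrite ltr0n; apply/card_gt0P; exists (\matrix_(i, j) true, \row_j true).
have W0 : 0 < W by rewrite ltr0n.
have J0 : (0 < #|J|)%N.
  rewrite lt0n; apply: contraTneq hJ => ->; rewrite mulr0 -ltNge ltr0n //.
have [J' [X' [G' [st' _ hJ' hG']]]] := next_stage _ _ _ _ st w l w7 N_l _ _ J0 (lexx _) (lexx _) (le_trans ler01 l1).
exists J', X', G'; split => //.
  by apply: (le_trans hJ); rewrite exprSr -mulrA ler_pM2l // exprn_gt0 // mulr_gt0.
apply: (le_trans hG); rewrite -natr1 mulrDl mul1r mulrDl.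
by move: hG'; rewrite -/loss; lra.
Qed.

(** A canonical representative of the matrices that agree with [A] outside [J]. *)
Definition mask_rows (J : {set 'I_N}) (A : mat) : mat :=
  \matrix_(i, j) ((i \notin J) && A i j).

Lemma card_masked_rows (J : {set 'I_N}) :
  #|[set A : mat | [forall i in J, row i A == const_mx false]]|%:R * (2 ^+ d) ^+ #|J|
  = #|{: mat}|%:R :> R.
Proof.
pose phi i (a : 'rV[bool]_d) : R := if i \in J then (a == const_mx false)%:R else 1.
have -> : #|[set A : mat | [forall i in J, row i A == const_mx false]]|%:R
    = \sum_(A : mat) \prod_i phi i (row i A).
  rewrite -sum1_card natr_sum big_mkcond /=; apply: eq_bigr => A _; rewrite inE.
  case: ifP => [/forall_inP h|/forall_inPn[i iJ /negbTE h]].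
    by rewrite big1 // => i _; rewrite /phi; case: ifP => // /h ->.
  by rewrite (bigD1 i) //= /phi iJ h mul0r.
rewrite sum_prod_rows (eq_bigr (fun i => if i \in J then 1 else 2 ^+ d)); last first.
  move=> i _; rewrite /phi; case: ifP => _.
    rewrite (bigD1 (const_mx false)) //= eqxx big1 ?addr0 //.
    by move=> a /negbTE ->.
  by rewrite sumr_const card_mx card_bool mul1n natrX.
rewrite prod_if_card expr1n mul1r -exprD addnC cardsC card_ord card_mx card_bool natrX.
by rewrite -exprM mulnC.
Qed.

(** By averaging, a fraction [p / 2] of the matrices are good for a fraction [p / 2] of the vectors.
    They are split by message and masked matrix, and [card_fibre] bounds each class. Its factor
    [(2 ^+ d) ^+ #|J|] cancels against the masking, which leaves [2 ^+ (k * d)] against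
    [(7 / 8) ^+ (r * #|J|)]. *)
Lemma density_bound (E sg : R) (r m Z : nat) (k' ka eta p : R) (J : {set 'I_N})
    (f : (k * d).-tuple bool -> vec -> mat -> 'rV[R]_d) (G : {set mat * vec}) :
  (forall mg v A, \sum_j f mg v A 0 j ^+ 2 <= 1) ->
  (forall mg v A A', (forall i, i \notin J -> row i A = row i A') -> f mg v A = f mg v A') ->
  (forall A v, (A, v) \in G -> #|bad_rows xi A (f (alice1 P A) v A) :&: J|%:R <= E /\
     sg <= `|dotb v (f (alice1 P A) v A)|) ->
  0 < k' -> 0 < ka -> 2 * (r%:R * m%:R) / k' <= Z%:R -> (0 < m)%N -> (Z.+1 <= m.+1 ^ 2)%N ->
  d%:R * k' + r%:R * m%:R * ka < eta -> xi < ka ->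
  d%:R * eta ^+ 2 <= 1 -> d%:R * eta <= sg / 2 ->
  (m.*2.+1)%:R ^+ r * (2 * expR (- (sg ^+ 2 / 128))) <= p / 4 ->
  0 <= p -> p * Omega <= #|G|%:R ->
  p / 2 * (p / 4) ^+ r <= 2 ^+ (k * d) * (expR (3 * (r%:R * E)) * (7 / 8) ^+ (r * #|J|)).
Proof.
move=> fb floc fG k0 ka0 hZ m0 hZm heta xika eta_d eta_sg hp p0 hG.
pose V A := [set v | (A, v) \in G].
pose F : {set mat} := [set A | p / 2 * 2 ^+ d <= #|V A|%:R].
have cmat0 : 0 < #|{: mat}|%:R :> R.
  by rewrite ltr0n; apply/card_gt0P; exists (\matrix_(i, j) true).
have cvec : #|{: vec}|%:R = 2 ^+ d :> R by rewrite card_mx card_bool mul1n natrX.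
have hF : p / 2 * #|{: mat}|%:R <= #|F|%:R.
  have G_sum : #|G|%:R = \sum_A #|V A|%:R :> R.
    rewrite -natr_sum; congr (_%:R).
    rewrite (eq_bigr (fun A => \sum_v if (A, v) \in G then 1 else 0))%N; last first.
      move=> A _; rewrite -sum1_card big_mkcond /=.
      by apply: eq_bigr => v _; rewrite inE.
    by rewrite pair_bigA -sum1_card big_mkcond /=; apply: eq_bigr => -[A v] _.
  have G_le : #|G|%:R <= #|F|%:R * 2 ^+ d + p / 2 * 2 ^+ d * #|{: mat}|%:R.
    rewrite G_sum (bigID (mem F)) /=; apply: lerD.
      rewrite mulr_natl -sumr_const; apply: ler_sum => A _.
      by rewrite -cvec ler_nat max_card.
    apply: (@le_trans _ _ (\sum_(A | A \notin F) p / 2 * 2 ^+ d)).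
      by apply: ler_sum => A; rewrite inE -ltNge => /ltW.
    rewrite [leRHS]mulr_natr -sumr_const big_mkcond; apply: ler_sum => A _; case: ifP => // _.
    by rewrite mulr_ge0 ?exprn_ge0 // divr_ge0.
  have O_E : Omega = #|{: mat}|%:R * 2 ^+ d by rewrite card_prod natrM cvec.
  rewrite -(ler_pM2r (_ : 0 < 2 ^+ d)) ?exprn_gt0 //.
  move: hG G_le; rewrite O_E.
  have -> : p / 2 * 2 ^+ d * #|{: mat}|%:R = p / 2 * #|{: mat}|%:R * 2 ^+ d by rewrite mulrAC.
  have -> : p * (#|{: mat}|%:R * 2 ^+ d) = p / 2 * #|{: mat}|%:R * 2 ^+ d + p / 2 * #|{: mat}|%:R * 2 ^+ d by field.
  by move: (p / 2 * _ * _) => a h1 h2; rewrite -(lerD2r a); exact: le_trans h1 h2.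
pose cl (A : mat) := (alice1 P A, mask_rows J A).
pose Bs := [set A : mat | [forall i in J, row i A == const_mx false]].
pose Q : R := expR (3 * (r%:R * E)) * (2 ^+ d * (7 / 8) ^+ r) ^+ #|J|.
have Q0 : 0 <= Q by rewrite mulr_ge0 ?expR_ge0 // exprn_ge0 // mulr_ge0 ?exprn_ge0 //; lra.
have p40 : 0 <= p / 4 by rewrite divr_ge0.
have fibre mg B : #|[set A in F | cl A == (mg, B)]|%:R * (p / 4) ^+ r <= Q.
  have [->|/set0Pn[A0]] := eqVneq [set A in F | cl A == (mg, B)] finset.set0.
    by rewrite cards0 mul0r.
  rewrite inE => /andP[A0F /eqP[mgE BE]].
  have same A : A \in [set A in F | cl A == (mg, B)] -> forall i, i \notin J -> row i A = row i A0.
    rewrite inE => /andP[_ /eqP[_ BA]] i iJ; apply/rowP => j; rewrite !mxE.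
    by have := BA; rewrite -BE => /matrixP/(_ i j); rewrite !mxE iJ.
  apply: (@card_fibre R N d (fun v => f mg v A0) r m Z J A0 _ k' ka eta xi E sg (p / 4)) => //.
  move=> A AF; have sm := same A AF; move: AF; rewrite inE => /andP[+ /eqP[mA _]].
  rewrite inE => hA; apply: (@le_trans _ _ #|V A|%:R).
    by apply: le_trans hA; rewrite (_ : 2 * (p / 4) = p / 2) //; field.
  rewrite ler_nat; apply: subset_leq_card; apply/fintype.subsetP => v; rewrite !inE => /fG[h1 h2].
  by rewrite (floc mg v A0 A) -?mA ?h1 ?h2 // => i iJ; rewrite sm.
have hsum : #|F|%:R * (p / 4) ^+ r <= (2 ^+ (k * d) * #|Bs|%:R) * Q.
  have -> : #|F|%:R = \sum_(c : (k * d).-tuple bool * mat | c.2 \in Bs) #|[set A in F | cl A == c]|%:R :> R.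
    rewrite -natr_sum; congr (_%:R); rewrite -sum1_card.
    rewrite (partition_big cl (fun c => c.2 \in Bs)) /=; last first.
      move=> A _; rewrite inE; apply/forall_inP => i iJ; apply/eqP/rowP => j.
      by rewrite !mxE iJ.
    by apply: eq_bigr => c _; rewrite -sum1_card; apply: eq_bigl => A; rewrite inE.
  rewrite mulr_suml; apply: (@le_trans _ _ (\sum_(c : (k * d).-tuple bool * mat | c.2 \in Bs) Q)).
    by apply: ler_sum => -[mg B] _; exact: fibre.
  rewrite sumr_const -[leLHS]mulr_natl ler_wpM2r //.
  have -> : #|[pred c : (k * d).-tuple bool * mat | c.2 \in Bs]| = (#|{: (k * d).-tuple bool}| * #|Bs|)%N.
    by rewrite -cardX; apply: eq_card => -[mg B]; rewrite !inE.
  by rewrite card_tuple card_bool natrM natrX.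
have cB : 0 < (2 ^+ d) ^+ #|J| :> R by rewrite !exprn_gt0.
rewrite -(ler_pM2r cmat0) [leLHS]mulrAC; apply: le_trans (_ : #|F|%:R * (p / 4) ^+ r <= _).
  by rewrite ler_wpM2r // exprn_ge0.
apply: (le_trans hsum); rewrite -(card_masked_rows J) -/Bs /Q exprMn -[((7 / 8) ^+ r) ^+ _]exprM.
by rewrite le_eqVlt; apply/orP; left; apply/eqP; ring.
Qed.

Lemma protocol_bound (L r m Z : nat) (k' ka eta : R) :
  1 / 2 <= success_prob P s xi ->
  L%:R * loss <= 1 / 4 -> 4 * (list_size L)%:R * (2 * W) ^+ L <= N%:R ->
  8 * W <= expR (4 * l) ->
  0 < k' -> 0 < ka -> 2 * (r%:R * m%:R) / k' <= Z%:R -> (0 < m)%N -> (Z.+1 <= m.+1 ^ 2)%N ->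
  d%:R * k' + r%:R * m%:R * ka < eta -> xi < ka ->
  d%:R * eta ^+ 2 <= 1 -> d%:R * eta <= Num.sqrt s / 2 ->
  let p := expR (- (2 * (list_size L)%:R / W)) / (32 * W) in
  (m.*2.+1)%:R ^+ r * (2 * expR (- (s / 128))) <= p / 4 ->
  exists h : nat, N%:R <= (2 * W) ^+ L.+1 * h%:R /\
    p / 2 * (p / 4) ^+ r <=
      2 ^+ (k * d) * (expR (3 * (r%:R * error_bound L.+1)) * (7 / 8) ^+ (r * h)).
Proof.
move=> hP hL hlist hW k0 ka0 hZ m0 hZm heta xika eta_d eta_sg p hp.
have W0 : 0 < W by rewrite ltr0n.
have [J [X [G [st hJ hG]]]] := iterated_stage L hP.
have WL0 : 0 < (2 * W) ^+ L by rewrite exprn_gt0 // mulr_gt0.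
have O0 : 0 < Omega by rewrite ltr0n; apply/card_gt0P; exists (\matrix_(i, j) true, \row_j true).
have J0 : (0 < #|J|)%N.
  by rewrite lt0n; apply: contraTneq hJ => ->; rewrite mulr0 -ltNge ltr0n.
have hG4 : Omega / 4 <= #|G|%:R.
  have : L%:R * loss * Omega <= 1 / 4 * Omega by rewrite ler_pM2r.
  by move: hG; move: (L%:R * loss * Omega) => a; lra.
have G0 : (0 < #|G|)%N by rewrite -(ltr0n R); apply: lt_le_trans hG4; rewrite divr_gt0.
have eJ : 4 * (list_size L)%:R <= #|J|%:R :> R.
  by rewrite -(ler_pM2r WL0); apply: (le_trans hlist); rewrite mulrC.
have [J' [f [G' [fb floc fG hJ' hG']]]] :=
  last_stage _ _ _ _ st w l w7 N_l _ J0 G0 (lexx _) l1 eJ hW.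
exists #|J'|; split.
  by apply: (le_trans hJ); rewrite exprSr -mulrA ler_pM2l.
have p0 : 0 <= p by rewrite divr_ge0 ?expR_ge0 // mulr_ge0 // ltW.
apply: (density_bound _ (Num.sqrt s) r m Z k' ka eta p J' f G') => //.
  by rewrite sqr_sqrtr.
apply: le_trans hG'; apply: le_trans (_ : Omega / 4 * (expR (- (2 * (list_size L)%:R / W)) / (8 * W)) <= _).
  by rewrite le_eqVlt; apply/orP; left; apply/eqP; rewrite /p; field; rewrite gt_eqF.
by rewrite ler_wpM2r // divr_ge0 ?expR_ge0 // mulr_ge0 // ltW.
Qed.

End ProtocolCounting.

(** * Growth of the lists and of the errors *)

Section Recurrences.
Context {R : realType}.

Lemma list_size_le (n w j : nat) (l : R) : 0 <= l -> (15 <= w)%N ->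
  (list_size (n := n) l w j)%:R <= n%:R * (3 / w.+1%:R) ^+ j + 8 * l.
Proof.
move=> l0 w15; have W16 : 16 <= w.+1%:R :> R by rewrite ler_nat.
have W0 : 0 < w.+1%:R :> R by lra.
elim: j => [|j IH] /=; first by rewrite expr0 mulr1 lerDl mulr_ge0.
set e := (list_size _ _ _)%:R in IH *.
apply: (@le_trans _ _ (3 * e / w.+1%:R + 4 * l)).
  by rewrite truncn_le addr_ge0 ?mulr_ge0 // ?invr_ge0 // mulr_ge0.
have -> : 3 * e / w.+1%:R = e * (3 / w.+1%:R) by ring.
have q0 : 0 <= 3 / w.+1%:R :> R by rewrite divr_ge0 // ltW.
have q1 : 3 / w.+1%:R <= 1 / 4 :> R by rewrite ler_pdivrMr //; lra.
have h1 : e * (3 / w.+1%:R) <= (n%:R * (3 / w.+1%:R) ^+ j + 8 * l) * (3 / w.+1%:R) by rewrite ler_wpM2r.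
rewrite exprSr (mulrA n%:R); move: h1; rewrite (mulrDl (n%:R * _)).
have h2 : 8 * l * (3 / w.+1%:R) <= 8 * l * (1 / 4) by rewrite ler_wpM2l // mulr_ge0.
move: h2; move: (8 * l * (3 / _)) (n%:R * _ * _) (e * _) => *; lra.
Qed.

(** The lists are estimated with ratio [8 / W] instead of [3 / W], so that they and the errors decay
    alike; each round then adds an equal share, hence the factor [j]. The factor [W] arises because
    a round is charged for the list before it is thinned. *)
Lemma error_bound_le (n w j : nat) (l : R) : 1 <= l -> (15 <= w)%N ->
  error_bound (n := n) l w j <=
    4 * l * j%:R * w.+1%:R * (n%:R * (8 / w.+1%:R) ^+ j) + 8 * l * (8 * l + 1).
Proof.
move=> l1 w15; have W16 : 16 <= w.+1%:R :> R by rewrite ler_nat.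
have W0 : 0 < w.+1%:R :> R by lra.
have l0 : 0 <= l by lra.
have b0 : 0 <= 8 * l * (8 * l + 1) by rewrite mulr_ge0 // ?addr_ge0 // mulr_ge0.
elim: j => [|j IH] /=; first by rewrite mulr0 !mul0r add0r.
set E := error_bound _ _ _ in IH *; set e := (list_size _ _ _)%:R.
have he : e <= n%:R * (8 / w.+1%:R) ^+ j + 8 * l.
  apply: (le_trans (list_size_le n w j l l0 w15)); rewrite lerD2r ler_wpM2l //.
  apply: lerXn2r; rewrite ?nnegrE ?divr_ge0 ?(ltW W0) //.
  by rewrite ler_pM2r ?invr_gt0 // ler_nat.
set z := n%:R * _ ^+ j in IH he.
have zS : n%:R * (8 / w.+1%:R) ^+ j.+1 = z * (8 / w.+1%:R) by rewrite exprSr (mulrA n%:R).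
have h1 : 8 * E / w.+1%:R <= 4 * l * j%:R * 8 * z + 4 * l * (8 * l + 1).
  rewrite ler_pdivrMr //.
  have h2 : 4 * l * (8 * l + 1) * 16 <= 4 * l * (8 * l + 1) * w.+1%:R.
    by rewrite ler_wpM2l // mulr_ge0 // ?addr_ge0 // mulr_ge0.
  move: IH h2; rewrite (mulrDl (_ * 8 * z)).
  have -> : 4 * l * j%:R * 8 * z * w.+1%:R = 8 * (4 * l * j%:R * w.+1%:R * z) by ring.
  have -> : 4 * l * (8 * l + 1) * 16 = 8 * (8 * l * (8 * l + 1)) by ring.
  move: (4 * l * (8 * l + 1) * _) (4 * l * j%:R * _ * z) (8 * l * _) => *; lra.
have h3 : 4 * l * (e + 1) <= 4 * l * (z + 8 * l + 1) by rewrite ler_wpM2l ?mulr_ge0 //; lra.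
rewrite zS.
have -> : 4 * l * j.+1%:R * w.+1%:R * (z * (8 / w.+1%:R)) = 4 * l * j%:R * 8 * z + 32 * (l * z).
  by rewrite -(natr1 j); field; rewrite gt_eqF.
have z0 : 0 <= l * z by rewrite mulr_ge0 // mulr_ge0 // exprn_ge0 // divr_ge0 // ltW.
move: h1 h3.
have -> : 4 * l * (z + 8 * l + 1) = 4 * (l * z) + 4 * l * (8 * l + 1) by ring.
have -> : 8 * l * (8 * l + 1) = 4 * l * (8 * l + 1) + 4 * l * (8 * l + 1) by ring.
move: z0; move: (l * z) (4 * l * (8 * l + 1)) (8 * E / _) (4 * l * j%:R * 8 * z) (4 * l * (e + 1)) => *; lra.
Qed.

End Recurrences.

(** * Choice of the parameters *)

Lemma half_bounds d : (200 <= d)%N ->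
  [/\ d <= 3 * d./2, 0 < d./2, 0 < d & (d./2).+1 <= d]%N.
Proof. by have := odd_double_half d; move: (d./2) => q; case: (odd d) => ? ?; split; lia. Qed.

Lemma doubleS_le q : (0 < q)%N -> (q.*2.+1 <= 3 * q)%N.
Proof. lia. Qed.

Lemma error_budget {R : realType} (f g x z H : R) : 0 <= H ->
  f <= 32 * x -> g <= 72 * z -> 200 * 200 * x <= H -> 200 * 200 * z <= H -> f + g <= H / 96.
Proof. by move=> *; lra. Qed.

(* The parameters stand for [l = ln d], [T = d ^ (1 / ln ln d)], [a = T ^ delta],
   [b = T ^ (1 - delta)], [y = d ^ (1 - delta / 2)], [D = d ^ (delta / 2)] and
   [X = l ^ 20]; [w.+1] is [u = sqrt a] rounded and [L] is the number of rounds. *)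
Section Numerics.
Context {R : realType} {d k n : nat} (P : protocol R d k n) (xi : R) (w L : nat).
Context (l X T a b u D y : R).
Local Notation W := (w.+1%:R : R).
Local Notation N := (d./2).
Local Notation s := (y * l ^+ 2).
Context (l200 : 200 <= l) (Xl : l ^+ 20 <= X) (aX : X <= a) (bX : X <= b) (TE : T = a * b)
  (ya : a * X <= y) (Dl : l <= D) (dE : d%:R = y * D) (d_exp : d%:R = expR l)
  (nT : n%:R * T <= d%:R) (kT : k%:R * d%:R * T <= y ^+ 2)
  (u16 : 16 <= u) (u2 : u ^+ 2 = a) (uW : u <= W) (Wu : W <= 2 * u)
  (DL : D <= u ^+ L) (LD : u ^+ L.+1 <= D * a) (L4 : 4 ^+ L.+1 <= l ^+ 4) (Ll : L.+1%:R <= l)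
  (xi_small : xi < expR (- (10 * l))).

Let l0 : 0 < l. Proof. by move: l200; lra. Qed.
Let l1 : 1 <= l. Proof. by move: l200; lra. Qed.
Let ll : 200 * 200 <= l ^+ 2.
Proof. by rewrite expr2; exact: (ler_pM (ler0n _ 200) (ler0n _ 200) l200 l200). Qed.
Let lpow i j : (i <= j)%N -> l ^+ i <= l ^+ j. Proof. by move=> ij; exact: ler_weXn2l. Qed.
Let lp i : 0 < l ^+ i. Proof. by rewrite exprn_gt0. Qed.
Let lX i : (i <= 20)%N -> l ^+ i <= X. Proof. by move=> /lpow h; apply: le_trans Xl. Qed.
Let X0 : 0 < X. Proof. by apply: lt_le_trans Xl. Qed.
Let a0 : 0 < a. Proof. exact: lt_le_trans aX. Qed.
Let b0 : 0 < b. Proof. exact: lt_le_trans bX. Qed.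
Let T0 : 0 < T. Proof. by rewrite TE mulr_gt0. Qed.
Let y0 : 0 < y. Proof. by apply: lt_le_trans ya; rewrite mulr_gt0. Qed.
Let u0 : 0 < u. Proof. by move: u16; lra. Qed.
Let W0 : 0 < W. Proof. exact: lt_le_trans uW. Qed.
Let D0 : 0 < D. Proof. exact: lt_le_trans Dl. Qed.
Let ua : u <= a. Proof. by rewrite -u2 expr2 ler_peMl ?(ltW u0) //; move: u16; lra. Qed.
Let w15 : (15 <= w)%N.
Proof. by rewrite -ltnS -(ler_nat R); exact: le_trans uW. Qed.
Let ly : l ^+ 20 <= y.
Proof.
apply: le_trans Xl _; apply: le_trans ya; rewrite ler_peMl ?(ltW X0) //.
by apply: le_trans aX; have := lX 0 isT; rewrite expr0.
Qed.
Let yd : y <= d%:R.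
Proof. by rewrite dE ler_peMr ?(ltW y0) //; exact: le_trans Dl. Qed.
Let ld i : (i <= 20)%N -> l ^+ i <= d%:R.
Proof. by move=> /lpow h; apply: le_trans h _; exact: le_trans yd. Qed.
Let d200 : (200 <= d)%N.
Proof. by rewrite -(ler_nat R); apply: le_trans (ld 1 isT); rewrite expr1. Qed.
Let dN : d%:R <= 3 * N%:R :> R.
Proof. by rewrite -natrM ler_nat; case: (half_bounds d d200). Qed.
Let N0 : (0 < N)%N. Proof. by case: (half_bounds d d200). Qed.
Let d0 : (0 < d)%N. Proof. by case: (half_bounds d d200). Qed.
Let N_l : N.+1%:R <= expR l :> R.
Proof. by rewrite -d_exp ler_nat; case: (half_bounds d d200). Qed.

Let Q : R := (2 * W) ^+ L.+1.
Let Q0 : 0 < Q. Proof. by rewrite exprn_gt0 // mulr_gt0. Qed.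
(** [H] bounds the number of finally hidden rows from below, and [nu] is the main term of the list
    length after [L] rounds, divided by [W]. *)
Let H : R := N%:R / Q.
Let nu : R := n%:R * (8 / W) ^+ L / W.
Let nu0 : 0 <= nu.
Proof. by rewrite !mulr_ge0 ?exprn_ge0 ?divr_ge0 ?invr_ge0 // ltW. Qed.

Let H0 : 0 < H. Proof. by rewrite divr_gt0 // ltr0n. Qed.

Let Q_le : Q <= l ^+ 4 * (D * a).
Proof.
apply: (@le_trans _ _ ((4 * u) ^+ L.+1)).
  apply: lerXn2r; rewrite ?nnegrE ?mulr_ge0 ?(ltW u0) ?(ltW W0) //.
  by move: Wu; lra.
by rewrite exprMn ler_pM // exprn_ge0 // ltW.
Qed.

Let yH : y <= 3 * l ^+ 4 * a * H.
Proof.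
rewrite /H mulrA ler_pdivlMr // -(ler_pM2r D0).
apply: (@le_trans _ _ (d%:R * (l ^+ 4 * (D * a)))).
  by rewrite dE [y * Q * D]mulrAC ler_wpM2l // mulr_ge0 // ltW.
apply: (@le_trans _ _ (3 * N%:R * (l ^+ 4 * (D * a)))).
  by rewrite ler_wpM2r // !mulr_ge0 // ltW.
by rewrite le_eqVlt; apply/orP; left; apply/eqP; ring.
Qed.

Let lH : l ^+ 15 <= H.
Proof.
have h1 : X <= 3 * l ^+ 4 * H.
  rewrite -(ler_pM2l a0); apply: le_trans ya _; apply: (le_trans yH).
  by rewrite le_eqVlt; apply/orP; left; apply/eqP; ring.
rewrite -(ler_pM2l (lp 5)) -exprD; apply: (le_trans Xl); apply: (le_trans h1).
rewrite ler_pM2r // (exprS l 4) ler_pM2r //; move: l200; lra.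
Qed.

(** All powers of [W] cancel in [nu * Q]. What the rounds lose is [16 ^ L], a power of [l], against
    the gain [T] from [n%:R * T <= d%:R]. *)
Let nu_T : nu * T <= 3 * l ^+ 8 * H.
Proof.
have e1 : nu * Q = 2 * (n%:R * 16 ^+ L).
  rewrite /nu /Q [in LHS]exprS exprMn (_ : 16 = 8 * 2); last by ring.
  rewrite !exprMn exprVn; field.
  by rewrite gt_eqF // expf_neq0 // gt_eqF.
have h16 : 2 * 16 ^+ L <= l ^+ 8.
  apply: (@le_trans _ _ ((4 ^+ L.+1) ^+ 2)).
    rewrite -exprM mulnC exprM (_ : 4 ^+ 2 = 16); last by rewrite expr2; lra.
    by rewrite exprS ler_pM2r ?exprn_gt0 // ler_nat.
  by rewrite (exprM _ 4 2); apply: lerXn2r; rewrite ?nnegrE ?exprn_ge0 // ltW.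
rewrite /H mulrA ler_pdivlMr // mulrAC e1.
have -> : 2 * (n%:R * 16 ^+ L) * T = 2 * 16 ^+ L * (n%:R * T) by ring.
apply: (@le_trans _ _ (l ^+ 8 * (3 * N%:R))).
  apply: ler_pM; first by rewrite mulr_ge0 ?exprn_ge0.
  - by rewrite mulr_ge0 ?(ltW T0).
  - exact: h16.
  - exact: le_trans nT dN.
by rewrite le_eqVlt; apply/orP; left; apply/eqP; ring.
Qed.

(** The lag of the errors behind the lists costs one factor [W], at most [2 * a]; of [T = a * b]
    there remains [b], which exceeds every power of [l] needed. *)
Let Wnu : W * nu * l ^+ 11 <= H.
Proof.
rewrite -(ler_pM2r (lp 9)) -(mulrA (W * nu)) -exprD.
apply: (@le_trans _ _ (2 * (nu * T))).
  apply: (@le_trans _ _ (2 * u * nu * b)).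
    apply: ler_pM; rewrite ?mulr_ge0 ?exprn_ge0 // ?(ltW W0) ?(ltW l0) //.
      by rewrite ler_wpM2r.
    exact: le_trans bX.
  have -> : 2 * u * nu * b = 2 * (nu * (u * b)) by ring.
  by rewrite TE ler_pM2l // ler_wpM2l // ler_pM2r.
apply: (@le_trans _ _ (2 * (3 * l ^+ 8 * H))); first by rewrite ler_pM2l.
have -> : 2 * (3 * l ^+ 8 * H) = 6 * (H * l ^+ 8) by ring.
have -> : H * l ^+ 9 = l * (H * l ^+ 8) by ring.
by rewrite (ler_pM2r (mulr_gt0 H0 (lp 8))); move: l200; lra.
Qed.

Let nuW : nu <= W * nu.
Proof. by rewrite ler_peMl // ler1n. Qed.

Let list_L : (list_size (n := n) l w L)%:R / W <= nu + 8 * l.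
Proof.
rewrite ler_pdivrMr // mulrDl /nu divfK ?gt_eqF //.
apply: le_trans (list_size_le n w L l (ltW l0) w15) _; apply: lerD.
  rewrite ler_wpM2l //; apply: lerXn2r; rewrite ?nnegrE ?divr_ge0 ?(ltW W0) //.
  by rewrite ler_pM2r ?invr_gt0 // ler_nat.
by rewrite ler_peMr ?mulr_ge0 ?(ltW l0) // ler1n.
Qed.

Let error_L : error_bound (n := n) l w L.+1 <= H / 96.
Proof.
apply: le_trans (error_bound_le n w L.+1 l l1 w15) _.
have e1 : n%:R * (8 / W) ^+ L.+1 = 8 * nu by rewrite /nu exprSr; field; rewrite gt_eqF.
rewrite e1.
have h1 : 4 * l * L.+1%:R * W * (8 * nu) <= 32 * (l ^+ 2 * (W * nu)).
  have -> : 4 * l * L.+1%:R * W * (8 * nu) = L.+1%:R * (32 * l * (W * nu)) by ring.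
  have -> : 32 * (l ^+ 2 * (W * nu)) = l * (32 * l * (W * nu)) by ring.
  by rewrite ler_wpM2r // !mulr_ge0 // ltW.
have h2 : 8 * l * (8 * l + 1) <= 72 * l ^+ 2.
  have -> : 72 * l ^+ 2 = 8 * l * (9 * l) by ring.
  by rewrite ler_wpM2l ?mulr_ge0 ?(ltW l0) //; move: l1; lra.
have h3 : 200 * 200 * (l ^+ 2 * (W * nu)) <= H.
  apply: le_trans Wnu; rewrite [leRHS]mulrC mulrA ler_wpM2r ?mulr_ge0 ?(ltW W0) //.
  apply: (@le_trans _ _ (l ^+ 2 * l ^+ 2)); last by rewrite -exprD lpow.
  by rewrite (ler_pM2r (lp 2)).
have h4 : 200 * 200 * l ^+ 2 <= H.
  apply: le_trans lH; apply: (@le_trans _ _ (l ^+ 2 * l ^+ 2)); last by rewrite -exprD lpow.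
  by rewrite (ler_pM2r (lp 2)).
exact: error_budget (ltW H0) h1 h2 h3 h4.
Qed.

(** Of [20 * l], the part [16 * l] comes from the additive term in the list length and [4 * l]
    absorbs the factor [128 * W]. *)
Let Lam : R := 2 * nu + 20 * l.

Let W128 : 128 * W <= expR (4 * l).
Proof.
rewrite (expR_natM 4) -d_exp.
apply: (@le_trans _ _ (d%:R ^+ 2)); last by rewrite ler_weXn2l // ler1n.
rewrite expr2; apply: ler_pM => //; first by rewrite ler_nat; apply: leq_trans d200.
apply: (le_trans Wu); apply: le_trans yd; apply: le_trans ya.
rewrite mulrC; apply: ler_pM => //; first by rewrite ltW.
by have := lX 1 isT; rewrite expr1; move: l200; lra.
Qed.

Local Notation p := (expR (- (2 * (list_size (n := n) l w L)%:R / W)) / (32 * W)).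

Let p_ge : expR (- Lam) <= p / 4.
Proof.
have -> : p / 4 = expR (- (2 * (list_size (n := n) l w L)%:R / W)) / (128 * W).
  by field; rewrite gt_eqF.
rewrite ler_pdivlMr ?mulr_gt0 //.
apply: (@le_trans _ _ (expR (- Lam) * expR (4 * l))); first by rewrite ler_pM2l ?expR_gt0.
rewrite -expRD ler_expR.
have e1 : 2 * (list_size (n := n) l w L)%:R / W <= 2 * (nu + 8 * l) by rewrite -mulrA ler_pM2l.
by move: e1; rewrite /Lam; move: (_ / W) => *; lra.
Qed.

(** This is what fixes the number of rounds: [D <= W ^+ L] brings [nu] from the order of [n] down to
    [y], with [T] absorbing the powers of [l]. *)
Let Lam_s : Lam + 1 <= s / 256.
Proof.
have h1 : nu * T <= y * l ^+ 8.
  have h16 : 8 ^+ L <= l ^+ 8.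
    apply: (@le_trans _ _ ((4 ^+ L.+1) ^+ 2)).
      rewrite -exprM mulnC exprM (_ : 4 ^+ 2 = 16); last by rewrite expr2; lra.
      apply: (@le_trans _ _ (16 ^+ L)); last by rewrite ler_weXn2l // ler1n.
      by apply: lerXn2r; rewrite ?nnegrE // ler_nat.
    by rewrite (exprM _ 4 2); apply: lerXn2r; rewrite ?nnegrE ?exprn_ge0 // ltW.
  have h2 : D <= W ^+ L.
    by apply: (le_trans DL); apply: lerXn2r; rewrite ?nnegrE // ltW.
  have h3 : nu <= n%:R * 8 ^+ L / D.
    rewrite /nu exprMn exprVn mulrA ler_pdivrMr //.
    apply: (@le_trans _ _ (n%:R * 8 ^+ L / D)).
      by rewrite ler_wpM2l ?mulr_ge0 ?exprn_ge0 // lef_pV2 ?posrE // exprn_gt0.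
    by rewrite ler_peMr ?ler1n // mulr_ge0 ?invr_ge0 ?(ltW D0) // mulr_ge0 // exprn_ge0.
  rewrite -(ler_pM2r D0); apply: (@le_trans _ _ (n%:R * 8 ^+ L * T)).
    by rewrite mulrAC ler_pM2r // -ler_pdivlMr.
  have -> : n%:R * 8 ^+ L * T = n%:R * T * 8 ^+ L by rewrite mulrAC.
  have -> : y * l ^+ 8 * D = d%:R * l ^+ 8 by rewrite dE mulrAC.
  by apply: ler_pM; rewrite ?mulr_ge0 ?exprn_ge0 ?(ltW T0).
have XT : X <= T.
  rewrite TE; apply: le_trans aX _; rewrite ler_peMr ?(ltW a0) //.
  by apply: le_trans bX; have := lX 0 isT; rewrite expr0.
have h2 : nu <= y.
  rewrite -(ler_pM2r (lp 8)); apply: le_trans h1; rewrite ler_wpM2l //.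
  exact: le_trans (lX 8 isT) XT.
have h3 : 21 * l <= y.
  apply: le_trans ly; apply: (@le_trans _ _ (l ^+ 2)); last exact: lpow.
  by rewrite expr2 ler_pM2r //; move: l200; lra.
have h4 : 200 * 200 * y <= s.
  by rewrite mulrC (ler_pM2l y0).
by move: h2 h3 h4 y0 l1; rewrite /Lam; move: (s) (nu) => *; lra.
Qed.

Let Lam_H : Lam <= H / 64.
Proof.
have h1 : 200 * nu <= H.
  apply: le_trans Wnu; rewrite mulrC; apply: ler_pM => //.
  by apply: (le_trans l200); have := lpow 1 11 isT; rewrite expr1.
have h2 : 200 * 200 * l <= H.
  apply: le_trans lH; apply: (@le_trans _ _ (l ^+ 2 * l)); first by rewrite (ler_pM2r l0).
  by rewrite -exprSr lpow.
by move: h1 h2 nu0 l0; rewrite /Lam; move: (H) (nu) => *; lra.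
Qed.

(** Combinations of [r] vectors with coefficients up to [d ^ 6] number at most [expR (8 * l * r)],
    hence at most [expR (8 * y)], which the tail [expR (- (s / 128))] overcomes. *)
Let r : nat := Num.truncn (y / l).

Let r_bounds : [/\ (0 < r)%N, r%:R <= y / l, y <= 2 * l * r%:R & r%:R <= d%:R :> R].
Proof.
have x2 : 2 <= y / l.
  rewrite ler_pdivlMr //; apply: le_trans ly; apply: (@le_trans _ _ (l ^+ 2)); last exact: lpow.
  by rewrite expr2 (ler_pM2r l0); move: l200; lra.
have x0 : 0 <= y / l by apply: le_trans x2.
have /andP[h1 h2] := truncn_itv x0; rewrite -/r in h1 h2; rewrite -(natr1 r) in h2.
split => //.
- by rewrite -(ltr0n R); move: x2 h2; move: (y / l) (r%:R) => *; lra.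
- have h : y / l <= 2 * r%:R by move: x2 h2; move: (y / l) (r%:R) => *; lra.
  by rewrite mulrAC -ler_pdivrMr.
- apply: (le_trans h1); rewrite ler_pdivrMr //; apply: (le_trans yd).
  by rewrite ler_peMr.
Qed.

Lemma no_protocol : ~ 1 / 2 <= success_prob P s xi.
Proof.
move=> hP; have [r0 rx xr rd] := r_bounds.
have d1 : 0 < d%:R :> R by rewrite ltr0n.
have d2 : 200 <= d%:R :> R by rewrite ler_nat.
have dp i : 0 < d%:R ^+ i :> R by rewrite exprn_gt0.
have dV i : 0 < (d%:R ^+ i)^-1 :> R by rewrite invr_gt0.
have loss_le : L%:R * (4 * W * expR (- (4 * l))) <= 1 / 4.
  have hL : L%:R <= d%:R :> R.
    apply: (@le_trans _ _ L.+1%:R); first by rewrite ler_nat.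
    by apply: (le_trans Ll); have := ld 1 isT; rewrite expr1.
  have hW : 16 * W * d%:R <= expR (4 * l).
    rewrite (expR_natM 4) -d_exp.
    apply: (@le_trans _ _ (d%:R ^+ 3)); last by rewrite ler_weXn2l // ler1n.
    have WD : W <= d%:R.
      apply: (le_trans Wu); apply: le_trans yd; apply: le_trans ya; rewrite mulrC.
      apply: ler_pM => //; first by rewrite ltW.
      by have := lX 1 isT; rewrite expr1; move: l200; lra.
    rewrite exprSr ler_pM2r // expr2; apply: ler_pM => //; move: d2; lra.
  rewrite expRN mulrA ler_pdivrMr ?expR_gt0 // mul1r.
  apply: (@le_trans _ _ (1 / 4 * (16 * W * d%:R))); last by rewrite mul1r ler_pM2l // invr_gt0.
  have -> : 1 / 4 * (16 * W * d%:R) = d%:R * (4 * W) by field.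
  by rewrite ler_pM2r // mulr_gt0.
have list_le : 4 * (list_size (n := n) l w L)%:R * (2 * W) ^+ L <= N%:R.
  have h1 : (list_size (n := n) l w L)%:R <= W * (nu + 8 * l) by rewrite mulrC -ler_pdivrMr.
  have h2 : 4 * W * (nu + 8 * l) <= 2 * W * H.
    have := Lam_H; rewrite /Lam => h.
    have -> : 4 * W * (nu + 8 * l) = 2 * W * (2 * (nu + 8 * l)) by ring.
    rewrite ler_pM2l ?mulr_gt0 //; move: h l0 H0 nu0; move: (H) (nu) => *; lra.
  have -> : N%:R = 2 * W * H * (2 * W) ^+ L by rewrite -[LHS](divfK (lt0r_neq0 Q0)) -/H /Q exprS; ring.
  rewrite ler_pM2r ?exprn_gt0 ?mulr_gt0 //; apply: le_trans h2.
  by rewrite -[4 * W * _]mulrA ler_pM2l.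
have W8 : 8 * W <= expR (4 * l).
  by apply: le_trans W128; rewrite ler_pM2r // ler_nat.
(* The parameters are powers of [d]: [m = d ^ 6], [Z = 2 * d ^ 11], [k' = d ^ -4], [ka = d ^ -10],
   [eta = d ^ -2]. The requirements become [2 * d ^ -3 < d ^ -2] for robustness, [Z] below about
   [m ^ 2 = d ^ 12], and [xi < d ^ -10]. *)
have hZ : 2 * (r%:R * (d ^ 6)%:R) / (d%:R ^+ 4)^-1 <= (2 * d ^ 11)%:R :> R.
  rewrite invrK natrM !natrX (_ : d%:R ^+ 11 = d%:R * d%:R ^+ 6 * d%:R ^+ 4); last by ring.
  by rewrite -!mulrA ler_pM2l // ler_pM2r ?mulr_gt0.
have hm : (0 < d ^ 6)%N by rewrite expn_gt0 d0.
have hZm : ((2 * d ^ 11).+1 <= (d ^ 6).+1 ^ 2)%N.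
  apply: (@leq_trans ((d ^ 6) ^ 2).+1); last by rewrite ltn_exp2r.
  rewrite ltnS -expnM (expnS d 11) leq_mul2r; apply/orP; right.
  exact: leq_trans d200.
have heta : d%:R * (d%:R ^+ 4)^-1 + r%:R * (d ^ 6)%:R * (d%:R ^+ 10)^-1 < (d%:R ^+ 2)^-1 :> R.
  rewrite natrX; apply: (@le_lt_trans _ _ (2 * (d%:R ^+ 3)^-1)).
    have -> : 2 * (d%:R ^+ 3)^-1 = d%:R * (d%:R ^+ 4)^-1 + d%:R * d%:R ^+ 6 * (d%:R ^+ 10)^-1 :> R.
      by field; rewrite gt_eqF.
    by rewrite lerD2l ler_pM2r // ler_pM2r //.
  have -> : 2 * (d%:R ^+ 3)^-1 = 2 / d%:R * (d%:R ^+ 2)^-1 :> R by field; rewrite gt_eqF.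
  by rewrite gtr_pMl // ltr_pdivrMr // mul1r; move: d2; lra.
have hxi : xi < (d%:R ^+ 10)^-1.
  by apply: lt_le_trans xi_small _; rewrite expRN (expR_natM 10) -d_exp.
have eta_d : d%:R * (d%:R ^+ 2)^-1 ^+ 2 <= 1 :> R.
  rewrite -exprVn -exprM (_ : d%:R * _ = (d%:R ^+ 3)^-1); last by field; rewrite gt_eqF.
  by rewrite invf_le1 // exprn_ege1 // ler1n.
have s1 : 1 <= s.
  by rewrite -[1]mulr1; apply: ler_pM => //; [apply: le_trans ly; exact: exprn_ege1|exact: exprn_ege1].
have eta_s : d%:R * (d%:R ^+ 2)^-1 <= Num.sqrt s / 2 :> R.
  have -> : d%:R * (d%:R ^+ 2)^-1 = d%:R^-1 :> R by field; rewrite gt_eqF.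
  have h : 1 <= Num.sqrt s by rewrite -[leLHS]sqrtr1 ler_wsqrtr.
  apply: (@le_trans _ _ 2^-1); first by rewrite lef_pV2 ?posrE //; move: d2; lra.
  by move: h; move: (Num.sqrt _) => *; lra.
have hp : (d ^ 6).*2.+1%:R ^+ r * (2 * expR (- (s / 128))) <= p / 4.
  apply: le_trans p_ge.
  have h1 : (d ^ 6).*2.+1%:R <= expR (8 * l).
    rewrite (expR_natM 8) -d_exp -natrX ler_nat (expnD d 2 6).
    apply: (@leq_trans (3 * d ^ 6)); first exact: doubleS_le.
    rewrite leq_mul2r; apply/orP; right; apply: (@leq_trans (2 ^ 2)) => //.
    by rewrite leq_exp2r //; exact: leq_trans d200.
  have h2 : 2 <= expR 1 :> R by have := expR_ge1Dx (1 : R); lra.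
  apply: (@le_trans _ _ (expR (8 * l) ^+ r * (expR 1 * expR (- (s / 128))))).
    apply: ler_pM; rewrite ?exprn_ge0 // ?mulr_ge0 ?expR_ge0 //.
      by apply: lerXn2r; rewrite ?nnegrE ?expR_ge0.
    by rewrite ler_pM2r ?expR_gt0.
  rewrite -expR_natM -!expRD ler_expR.
  have h3 : r%:R * (8 * l) <= 8 * y.
    have -> : 8 * y = y / l * (8 * l) by field; rewrite gt_eqF.
    by rewrite ler_pM2r // mulr_gt0.
  have h4 : 200 * 200 * y <= s by rewrite mulrC (ler_pM2l y0).
  by move: Lam_s h3 h4 y0; move: (s) (Lam) (r%:R * _) => *; lra.
have [h [hN hbound]] := protocol_bound P s xi l w d0 (le_trans ler01 s1)
  (leq_trans (isT : 7 <= 15)%N w15) l1 N0 N_l L r (d ^ 6) (2 * d ^ 11) _ _ _ hP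
  loss_le list_le W8 (dV 4%N) (dV 10%N) hZ hm hZm heta hxi eta_d eta_s hp.
have Hh : H <= h%:R by rewrite ler_pdivrMr // mulrC.
have rR0 : 0 < r%:R :> R by rewrite ltr0n.
have lhs : expR (- (2 * r%:R * Lam)) <= p / 2 * (p / 4) ^+ r.
  have Lam0 : 0 <= Lam by rewrite /Lam addr_ge0 // mulr_ge0 // ltW.
  have p0 : 0 <= p by rewrite divr_ge0 ?expR_ge0 // mulr_ge0 // ltW.
  apply: (@le_trans _ _ (p / 4 * (p / 4) ^+ r)); last first.
    by rewrite ler_wpM2r ?exprn_ge0 ?divr_ge0 // ler_wpM2l // lef_pV2 ?posrE // ler_nat.
  apply: (@le_trans _ _ (expR (- Lam) ^+ r.+1)).
    rewrite -expR_natM ler_expR mulrN lerN2 ler_wpM2r // -natr1.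
    have : 1 <= r%:R :> R by rewrite ler1n.
    by move: (r%:R) => *; lra.
  by rewrite -exprS; apply: lerXn2r; rewrite ?nnegrE ?expR_ge0 // divr_ge0.
have rhs : 2 ^+ (k * d) * (expR (3 * (r%:R * error_bound (n := n) l w L.+1)) * (7 / 8) ^+ (r * h))
   <= expR (k%:R * d%:R + 3 * (r%:R * (H / 96)) - r%:R * h%:R / 8).
  have h2 : 2 <= expR 1 :> R by have := expR_ge1Dx (1 : R); lra.
  have h7 : 7 / 8 <= expR (- (1 / 8)) :> R by have := expR_ge1Dx (- (1 / 8) : R); lra.
  rewrite -addrA expRD; apply: ler_pM.
  - exact: exprn_ge0.
  - by apply: mulr_ge0; [exact: expR_ge0|apply: exprn_ge0; lra].
  - rewrite -natrM -[(k * d)%:R]mulr1 expR_natM.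
    by apply: lerXn2r; rewrite ?nnegrE ?expR_ge0.
  - rewrite expRD; apply: ler_pM; rewrite ?expR_ge0 //.
    + by rewrite ler_expR ler_pM2l // ler_pM2l.
    + rewrite (_ : expR (- (r%:R * h%:R / 8)) = expR (- (1 / 8)) ^+ (r * h)).
        by apply: lerXn2r; rewrite ?nnegrE ?expR_ge0 //; lra.
      by rewrite -expR_natM natrM; congr expR; field.
have kd : k%:R * d%:R <= r%:R * H / 32.
  have h1 : k%:R * d%:R * T <= 3 * l ^+ 4 * a * y * H.
    apply: (le_trans kT); rewrite expr2.
    have -> : 3 * l ^+ 4 * a * y * H = y * (3 * l ^+ 4 * a * H) by ring.
    by rewrite ler_pM2l.
  have h3 : 32 * (3 * l ^+ 4 * a * y * H) <= r%:R * H * T.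
    rewrite TE; have -> : 32 * (3 * l ^+ 4 * a * y * H) = 96 * l ^+ 4 * y * (a * H) by ring.
    have -> : r%:R * H * (a * b) = b * r%:R * (a * H) by ring.
    rewrite (ler_pM2r (mulr_gt0 a0 H0)).
    apply: (@le_trans _ _ (96 * l ^+ 4 * (2 * l * r%:R))).
      by rewrite ler_pM2l // mulr_gt0.
    have -> : 96 * l ^+ 4 * (2 * l * r%:R) = 192 * l ^+ 5 * r%:R by ring.
    rewrite (ler_pM2r rR0); apply: le_trans bX; apply: le_trans (lX 6 isT).
    by rewrite (exprS l 5) (ler_pM2r (lp 5)); move: l200; lra.
  rewrite ler_pdivlMr // -(ler_pM2r T0); apply: le_trans h3.
  by rewrite mulrAC mulrC ler_pM2l.
(* In units of [r%:R * H / 32], the density, the message and the errors account for at most one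
   each, whereas the hidden rows contribute four. *)
have := le_trans lhs (le_trans hbound rhs); rewrite ler_expR.
have t1 : 2 * r%:R * Lam <= r%:R * H / 32.
  have -> : r%:R * H / 32 = 2 * r%:R * (H / 64) by field.
  by rewrite ler_pM2l // mulr_gt0.
have t2 : 3 * (r%:R * (H / 96)) = r%:R * H / 32 by field.
have t3 : r%:R * H <= r%:R * h%:R by rewrite ler_pM2l.
have t4 : 0 < r%:R * H := mulr_gt0 rR0 H0.
move: kd t1 t3 t4; rewrite t2.
by move: (r%:R * H) (r%:R * h%:R) (2 * r%:R * Lam) (k%:R * d%:R) => *; lra.
Qed.

End Numerics.

(** * Asymptotics *)

Lemma no_fast_protocol {R : realType} {d k n : nat} (P : protocol R d k n) (del l lam : R) :
  540 <= del * lam -> 540 <= (1 - del) * lam -> l = expR lam -> d%:R = expR l ->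
  n%:R * expR (l / lam) <= d%:R -> k%:R <= expR ((1 - del - lam^-1) * l) ->
  ~ (1 / 2 <= success_prob P (expR ((1 - del / 2) * l) * l ^+ 2) (2 * expR (- l ^+ 5))).
Proof.
move=> dl1 dl2 lE dE nT kT.
have lam1080 : 1080 <= lam by move: dl1 dl2; rewrite mulrBl mul1r; lra.
have lam0 : 0 < lam by move: lam1080; lra.
have cube : 1 / 27 * lam * lam ^+ 2 <= l.
  rewrite lE (_ : lam = 3%:R * (lam / 3)); last by field.
  rewrite expR_natM; have h : lam / 3 <= expR (lam / 3).
    by have := expR_ge1Dx (lam / 3); move: (expR _) => *; lra.
  have -> : 1 / 27 * (3%:R * (lam / 3)) * (3%:R * (lam / 3)) ^+ 2 = (lam / 3) ^+ 3 by field.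
  by apply: lerXn2r; rewrite ?nnegrE ?expR_ge0 ?divr_ge0 // ltW.
(* Here [540 = 20 * 27], with 27 from the cubic bound [(lam / 3) ^+ 3 <= l]. Applied to [del] and
   [1 - del], this places both [a] and [b] above [l ^+ 20]. *)
have small x : 0 <= x -> 540 <= x * lam -> 20 * lam <= x * (l / lam).
  move=> x0 xl; rewrite mulrA ler_pdivlMr //; apply: le_trans (ler_wpM2l x0 cube).
  have -> : 20 * lam * lam = 20 * lam ^+ 2 by ring.
  have -> : x * (1 / 27 * lam * lam ^+ 2) = x * lam / 27 * lam ^+ 2 by field.
  by rewrite ler_pM2r ?exprn_gt0 //; move: xl; move: (x * lam) => *; lra.
have del0 : 0 <= del by rewrite -(pmulr_lge0 _ lam0); move: dl1; lra.
have del1 : 0 <= 1 - del by rewrite -(pmulr_lge0 _ lam0); move: dl2; lra.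
have small1 := small _ del0 dl1.
have small2 := small _ del1 dl2.
have qE : l / lam * lam = l by rewrite divfK // gt_eqF.
have nTl := nT; move: small1 small2 qE nT; set q := l / lam => small1 small2 qE nT.
have sum12 : 40 * lam <= q by move: small1 small2; rewrite mulrBl mul1r; lra.
have q0 : 0 < q by move: sum12 lam0; lra.
have ql : 1080 * q <= l by rewrite -qE mulrC ler_pM2l.
have l0 : 0 < l by rewrite lE expR_gt0.
set u := expR (del * q / 2).
have u16 : 16 <= u.
  by have := expR_ge1Dx (del * q / 2); rewrite -/u; move: small1 lam1080; lra.
have u1 : 1 <= u by move: u16; lra.
have Lbd : lam < (Num.truncn lam).+1%:R by apply: truncnS_gt.
have Lbd2 : (Num.truncn lam).+1%:R <= lam + 1 by rewrite -natr1 lerD2r truncn_le ltW.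
have delq : 0 <= del * q / 2 by rewrite divr_ge0 // mulr_ge0 // ltW.
have dq : del * q <= q.
  by rewrite -[leRHS]mul1r ler_pM2r //; move: del1; lra.
have ll : 200 * l <= l ^+ 2 by rewrite expr2 ler_pM2r //; move: ql sum12 lam1080; lra.
(* Since [D = u ^ lam], the least integer above [lam] is the number of rounds after which [u ^ L]
   has passed [D], by a factor of at most [u]. *)
apply: (@no_protocol R d k n P _ (Num.truncn u) (Num.truncn lam).+1 l (expR (20 * lam)) (expR q)
  (expR (del * q)) (expR ((1 - del) * q)) u (expR (del * l / 2)) (expR ((1 - del / 2) * l))).
- by move: ql sum12 lam1080; lra.
- by rewrite [in leLHS]lE -expR_natM.
- by rewrite ler_expR.
- by rewrite ler_expR.
- by rewrite -expRD; congr expR; ring.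
- rewrite -expRD ler_expR.
  have h : del * l <= l by rewrite -[leRHS]mul1r ler_pM2r //; move: del1; lra.
  have -> : (1 - del / 2) * l = l - del * l / 2 by field.
  by move: h sum12 dq lam0 ql q0; lra.
- rewrite [leLHS]lE ler_expR.
  have h : del * q <= del * l by rewrite ler_wpM2l //; move: ql q0; lra.
  by move: h small1 lam0; lra.
- by rewrite dE -expRD; congr expR; field.
- exact: dE.
- exact: nT.
- apply: (@le_trans _ _ (expR ((1 - del - lam^-1) * l) * expR l * expR q)).
    by rewrite dE !ler_pM2r ?expR_gt0.
  rewrite -!expRD -(expR_natM 2) ler_expR.
  have -> : (1 - del - lam^-1) * l = l - del * l - q by rewrite /q; ring.
  by rewrite (_ : 2%:R * _ = l - del * l - q + l + q) //; field.
- exact: u16.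
- by rewrite -(expR_natM 2); congr expR; field.
- by apply: ltW; apply: truncnS_gt.
- have h : (Num.truncn u)%:R <= u by rewrite truncn_le ltW // expR_gt0.
  by rewrite -[leLHS]natr1; move: h u1; lra.
- rewrite -expR_natM ler_expR.
  have -> : del * l / 2 = lam * (del * q / 2) by rewrite -qE; field.
  by apply: ler_wpM2r => //; exact: ltW.
- rewrite -expR_natM -expRD ler_expR.
  have -> : del * l / 2 + del * q = (lam + 2) * (del * q / 2) by rewrite -qE; field.
  by apply: ler_wpM2r => //; rewrite -[leLHS]natr1; move: Lbd2; lra.
- have e2 : 4 <= expR 2 :> R.
    apply: (@le_trans _ _ (expR 1 ^+ 2)); last by rewrite -expR_natM mulr1.
    have h : 2 <= expR 1 :> R by have := expR_ge1Dx (1 : R); lra.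
    by rewrite expr2; have := ler_pM (ler0n R 2) (ler0n R 2) h h; lra.
  apply: (@le_trans _ _ (expR 2 ^+ (Num.truncn lam).+2)).
    by apply: lerXn2r; rewrite ?nnegrE ?expR_ge0.
  rewrite lE -!expR_natM ler_expR -(natr1 (Num.truncn lam).+1).
  by move: Lbd2 lam1080; move: (_.+1%:R) => *; lra.
- by rewrite -[leLHS]natr1; move: Lbd2 ql sum12 lam1080; lra.
- have h2 : 2 <= expR 1 :> R by have := expR_ge1Dx (1 : R); lra.
  apply: (@le_lt_trans _ _ (expR 1 * expR (- l ^+ 5))).
    by rewrite ler_pM2r // expR_gt0.
  rewrite -expRD ltr_expR.
  have h : l ^+ 2 <= l ^+ 5 by apply: ler_weXn2l => //; move: ql sum12 lam1080; lra.
  by move: h ll ql sum12 lam1080; move: (l ^+ 2) (l ^+ 5) => *; lra.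
Qed.

Lemma large_lnln {R : realType} (M : R) :
  exists D : nat, forall d : nat, (D <= d)%N -> [/\ (0 < d)%N, 0 < ln (d%:R : R) & M < ln (ln (d%:R : R))].
Proof.
exists (Num.truncn (expR (expR M))).+1 => d Dd.
have d0 : (0 < d)%N by apply: leq_trans Dd.
have h : expR (expR M) < d%:R.
  by apply: (@lt_le_trans _ _ (Num.truncn (expR (expR M))).+1%:R); [apply: truncnS_gt|rewrite ler_nat].
have h1 : expR M < ln (d%:R : R) by rewrite -ltr_expR lnK // posrE ltr0n.
have h2 : 0 < ln (d%:R : R) by apply: lt_trans h1; exact: expR_gt0.
by split=> //; rewrite -ltr_expR lnK.
Qed.

Local Open Scope classical_set_scope.
Local Open Scope ring_scope.

Lemma cvg_inv_lnln (R : realType) : (fun d : nat => (ln (ln (d%:R : R)))^-1) @ \oo --> 0.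
Proof.
apply/cvgr0Pnorm_le => e e0; have [D HD] := large_lnln e^-1.
exists D => // d /= /HD [_ _ h].
have h0 : 0 < ln (ln d%:R : R) by apply: lt_trans h; rewrite invr_gt0.
rewrite ger0_norm ?invr_ge0 1?ltW // -[e]invrK ltf_pV2 ?posrE ?invr_gt0 //.
Qed.

Theorem theorem5p1 (R : realType) (delta : R) :
  0 < delta < 1 ->
  exists eps : nat -> R, eps @ \oo --> 0 /\
  exists D : nat, forall d k n : nat, (D <= d)%N -> ~~ odd d ->
    (k%:R <= powR (d%:R) (1 - delta - eps d)) ->
    forall P : protocol R d k n,
      solves P (powR (d%:R) (1 - delta / 2) * (ln (d%:R)) ^+ 2)
               (2 * expR (- (ln (d%:R)) ^+ 5)) (1 / 2) ->
      (d%:R : R) * expR (- (ln (d%:R : R) / ln (ln (d%:R : R)))) <= n%:R.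
Proof.
move=> /andP[del0 del1]; have del1' : 0 < 1 - delta by rewrite subr_gt0.
(* With this exponent [d ^ (- eps d)] is [exp (- ln d / ln ln d)], so [k] is reduced by the same
   factor as the claimed bound on [n]. *)
exists (fun d => (ln (ln d%:R))^-1); split; first exact: cvg_inv_lnln.
have [D HD] := large_lnln (540 / delta + 540 / (1 - delta)).
exists D => d k n /HD[d0 l0 lam_large] _ kle P sol.
rewrite leNgt; apply/negP => n_lt; move: sol; rewrite /solves.
have dR : d%:R != 0 :> R by rewrite pnatr_eq0 -lt0n.
have dE : d%:R = expR (ln d%:R) :> R by rewrite lnK // posrE ltr0n.
have s1 : 0 < 540 / delta by apply: (divr_gt0 _ del0); rewrite ltr0n.
have s2 : 0 < 540 / (1 - delta) by apply: (divr_gt0 _ del1'); rewrite ltr0n.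
move: kle; rewrite /powR (negPf dR) => kle.
have lam1 : 540 <= delta * ln (ln d%:R).
  by rewrite mulrC -ler_pdivrMr //; move: s2 lam_large; move: (_ / _) (_ / _) => *; lra.
have lam2 : 540 <= (1 - delta) * ln (ln d%:R).
  by rewrite mulrC -ler_pdivrMr //; move: s1 lam_large; move: (_ / _) (_ / _) => *; lra.
apply: (no_fast_protocol _ _ _ _ lam1 lam2 _ dE _ kle).
- by rewrite lnK.
- by rewrite -ler_pdivlMr ?expR_gt0 // -expRN ltW.
Qed.
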